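(* Let $0<q\le1$ and $\lambda>1$. There exists $f\in\mathcal{HM}_q^\lambda(\mathbb{R}^n)$ such that $\widehat f(\xi)$ is not continuous at $\xi=0$.
   Context: For $0<q\le\lambda<\infty$ and measurable $g$ on $\mathbb{R}^n$, set $\|g\|_{\mathcal{M}_q^\lambda}:=\sup_Q |Q|^{1/\lambda-1/q}\big(\int_Q|g(y)|^q\,dy\big)^{1/q}$, the supremum being over all cubes $Q\subset\mathbb{R}^n$. Fix $\varphi\in\mathcal{S}(\mathbb{R}^n)$ with $\int\varphi\neq0$ and put $\varphi_t(x)=t^{-n}\varphi(x/t)$. For $f\in\mathcal{S}'(\mathbb{R}^n)$ let $M_\varphi f(x)=\sup_{0<t<\infty}|\varphi_t*f(x)|$. The Hardy-Morrey space $\mathcal{HM}_q^\lambda(\mathbb{R}^n)$ is the set of $f\in\mathcal{S}'(\mathbb{R}^n)$ with $\|f\|_{\mathcal{HM}_q^\lambda}:=\|M_\varphi f\|_{\mathcal{M}_q^\lambda}<\infty$ (independent of the choice of $\varphi$ up to equivalence of quasi-norms). The Fourier transform is $\widehat\varphi(\xi)=\int_{\mathbb{R}^n}e^{-ix\cdot\xi}\varphi(x)\,dx$, extended to $\mathcal{S}'(\mathbb{R}^n)$ by duality. That $\widehat f$ is not continuous at $0$ means that $\widehat f$ does not coincide, on any neighbourhood of $0$, with a function continuous at $0$. *)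

(* Defs.v *)
From HB Require Import structures.
From mathcomp Require Import all_boot all_order all_algebra.
From mathcomp Require Import all_classical all_reals all_analysis.
From mathcomp Require Import complex.

Set Implicit Arguments.
Unset Strict Implicit.
Unset Printing Implicit Defensive.

Import Order.TTheory GRing.Theory Num.Theory.
Import numFieldTopology.Exports numFieldNormedType.Exports.
Import ComplexField.Normc.

Local Open Scope classical_set_scope.
Local Open Scope ring_scope.
Local Open Scope complex_scope.

(* R^n is 'rV[R]_n with the sigma-algebra generated by the coordinate maps,
   which is the Borel sigma-algebra. *)
Definition measure_rV_display : measure_display -> measure_display.
Proof. exact. Qed.

Section measurable_rV.
Context {d : measure_display} {T : measurableType d}.
Variable n : nat.

Let coors : 'I_n -> 'rV[T]_n -> T := fun i x => x ord0 i.

Let rV_set0 : g_sigma_preimage coors set0.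
Proof. exact: sigma_algebra0. Qed.

Let rV_setC A : g_sigma_preimage coors A -> g_sigma_preimage coors (~` A).
Proof. exact: sigma_algebraC. Qed.

Let rV_bigcup (F : (set _)^nat) : (forall i, g_sigma_preimage coors (F i)) ->
  g_sigma_preimage coors (\bigcup_i (F i)).
Proof. exact: sigma_algebra_bigcup. Qed.

HB.instance Definition _ := @isMeasurable.Build (measure_rV_display d)
  'rV[T]_n (g_sigma_preimage coors) rV_set0 rV_setC rV_bigcup.

End measurable_rV.

Lemma measurable_fun_rVP d1 (T1 : measurableType d1) d2
    (T2 : measurableType d2) n (f : T1 -> 'rV[T2]_n) :
  measurable_fun [set: T1] f <->
  forall i, measurable_fun [set: T1] (fun x => f x ord0 i).
Proof.
split=> [mf i|mf].
- move=> _ A mA; rewrite setTI.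
  have := mf measurableT ((fun x : 'rV[T2]_n => x ord0 i) @^-1` A).
  rewrite setTI; apply; apply: sub_sigma_algebra => /=.
  rewrite -bigcup_seq/=; exists i => /=; first by rewrite mem_index_enum.
  by exists A => //; rewrite setTI.
- move=> _ A mA; rewrite setTI.
  suff sub : measurable `<=` [set B | measurable (f @^-1` B)] by exact: sub.
  apply: smallest_sub; first split => /=.
  + by rewrite preimage_set0.
  + by move=> B mB; rewrite setTD preimage_setC; exact: measurableC.
  + by move=> F mF; rewrite preimage_bigcup; exact: bigcup_measurable.
  + rewrite -bigcup_seq; apply: bigcup_sub => i _ _ [B mB <-] /=.
    by rewrite setTI; have := mf i measurableT B mB; rewrite setTI.
Qed.

Section lebesgue_rV.
Context {R : realType}.

Definition rV_cons n (p : measurableTypeR R * 'rV[R]_n) : 'rV[R]_n.+1 :=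
  @row_mx R 1 1 n (const_mx p.1) p.2.

Lemma measurable_rV_cons n : measurable_fun setT (@rV_cons n).
Proof.
apply/measurable_fun_rVP => i; case: (@split_ordP 1 n i) => j ->.
- apply: (eq_measurable_fun fst) => [p _|]; last exact: measurable_fst.
  by rewrite [RHS]row_mxEl mxE.
- apply: (eq_measurable_fun
      (fun p : measurableTypeR R * 'rV[R]_n => p.2 ord0 j)) => [p _|].
    by rewrite [RHS]row_mxEr.
  have := (measurable_fun_rVP (@snd (measurableTypeR R) 'rV[R]_n)).1.
  by apply; exact: measurable_snd.
Qed.

Definition rV_uncons n (v : 'rV[R]_n.+1) : measurableTypeR R * 'rV[R]_n :=
  (v ord0 ord0, @rsubmx R 1 1 n v).

Lemma rV_consK n : cancel (@rV_cons n) (@rV_uncons n).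
Proof.
move=> [x v]; rewrite /rV_uncons /rV_cons row_mxKr; congr (_, _).
by rewrite mxE; case: (@split_ordP 1 n ord0) => j; rewrite ?mxE// => /(congr1 val).
Qed.

Lemma measurable_rV_uncons n : measurable_fun setT (@rV_uncons n).
Proof.
apply/measurable_fun_pairP; split.
- by have := (measurable_fun_rVP (@id 'rV[R]_n.+1)).1; apply.
- apply/measurable_fun_rVP => i; rewrite /rV_uncons/=.
  under eq_fun do rewrite mxE.
  by have := (measurable_fun_rVP (@id 'rV[R]_n.+1)).1; apply.
Qed.

Section step.
Variables (n : nat) (mu : {sigma_finite_measure set 'rV[R]_n -> \bar R}).
Local Open Scope ereal_scope.

Definition lebesgue_step : set 'rV[R]_n.+1 -> \bar R :=
  pushforward (@lebesgue_measure R \x mu) (@rV_cons n).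

Let measurable_rV_cons_preimage A :
  measurable A -> measurable (@rV_cons n @^-1` A).
Proof.
by move=> mA; rewrite -[X in measurable X]setTI; exact: measurable_rV_cons.
Qed.

Let lebesgue_step0 : lebesgue_step set0 = 0.
Proof. by rewrite /lebesgue_step /pushforward preimage_set0 measure0. Qed.

Let lebesgue_step_ge0 A : 0 <= lebesgue_step A.
Proof. exact: (measure_ge0 (@lebesgue_measure R \x mu)). Qed.

Let lebesgue_step_sigma_additive : semi_sigma_additive lebesgue_step.
Proof.
move=> F mF tF mUF; rewrite /lebesgue_step /pushforward preimage_bigcup.
apply: measure_semi_sigma_additive.
- by move=> i; exact: measurable_rV_cons_preimage.
- apply/trivIsetP => /= i j _ _ ij; rewrite -preimage_setI.
  by move/trivIsetP : tF => /(_ _ _ _ _ ij) ->//; rewrite preimage_set0.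
- by rewrite -preimage_bigcup; exact: measurable_rV_cons_preimage.
Qed.

HB.instance Definition _ := isMeasure.Build _ _ _ lebesgue_step
  lebesgue_step0 lebesgue_step_ge0 lebesgue_step_sigma_additive.

Let lebesgue_step_sigma_finite : sigma_finite setT lebesgue_step.
Proof.
have /sigma_finiteP[F [TF ndF Foo]] := sigma_finiteT (@lebesgue_measure R).
have /sigma_finiteP[G [TG ndG Goo]] := sigma_finiteT mu.
exists (fun i => @rV_uncons n @^-1` (F i `*` G i)).
  rewrite -preimage_bigcup (_ : \bigcup_i _ = setT) ?preimage_setT//.
  apply/seteqP; split=> // -[x y] _.
  have [i _ Fx] : (\bigcup_i F i) x by rewrite -TF.
  have [j _ Gy] : (\bigcup_i G i) y by rewrite -TG.
  exists (maxn i j) => //; split => /=.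
  - by move: x Fx; exact/subsetPset/ndF/leq_maxl.
  - by move: y Gy; exact/subsetPset/ndG/leq_maxr.
move=> i; have [mF Fi] := Foo i; have [mG Gi] := Goo i; split.
  rewrite -[X in measurable X]setTI; apply: measurable_rV_uncons => //.
  exact: measurableX.
rewrite /lebesgue_step /pushforward -comp_preimage.
rewrite (_ : _ \o _ = id) ?preimage_id; last first.
  by apply/funext => p /=; rewrite rV_consK.
by rewrite product_measure1E// lte_mul_pinfty// ge0_fin_numE.
Qed.

HB.instance Definition _ := Measure_isSigmaFinite.Build _ _ _ lebesgue_step
  lebesgue_step_sigma_finite.

End step.

Fixpoint lebesgue_rV (n : nat) : {sigma_finite_measure set 'rV[R]_n -> \bar R} :=
  match n with
  | 0 => @dirac _ 'rV[R]_0 0 R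
  | m.+1 => lebesgue_step (lebesgue_rV m)
  end.

End lebesgue_rV.
Arguments lebesgue_rV : clear implicits.

Section distributions.
Context {R : realType} {n : nat}.
Implicit Types (D K U : set 'rV[R]_n) (f g phi psi : 'rV[R]_n -> R[i]).
Implicit Types (T : ('rV[R]_n -> R[i]) -> R[i]).

Definition cintegral D f : R[i] :=
  (\int[lebesgue_rV R n]_(x in D) complex.Re (f x)) +i*
  (\int[lebesgue_rV R n]_(x in D) complex.Im (f x)).

(* Derivatives, continuity and integrals of complex-valued functions are taken
   on real and imaginary parts. *)
Definition cpartial (i : 'I_n) f : 'rV[R]_n -> R[i] := fun x =>
  ('D_(delta_mx ord0 i) (fun y => complex.Re (f y)) x) +i*
  ('D_(delta_mx ord0 i) (fun y => complex.Im (f y)) x).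

Definition cpartials (s : seq 'I_n) f := foldr cpartial f s.

(* Differentiability of all iterated partial derivatives is C^oo. *)
Definition csmooth f := forall (s : seq 'I_n) (x : 'rV[R]_n),
  differentiable (fun y => complex.Re (cpartials s f y)) x /\
  differentiable (fun y => complex.Im (cpartials s f y)) x.

(* `|x| is the sup norm of 'rV[R]_n. The seminorms below are nondecreasing in N
   and generate the usual topology of the Schwartz space. *)
Definition schwartz_seminorm (N : nat) f : \bar R :=
  ereal_sup [set z | exists (s : seq 'I_n) (x : 'rV[R]_n), (size s <= N)%N /\
    z = ((1 + `|x|) ^+ N * normc (cpartials s f x))%:E].

Definition schwartz : set ('rV[R]_n -> R[i]) :=
  [set f | csmooth f /\ forall N, (schwartz_seminorm N f < +oo)%E].

(* A tempered distribution is encoded as a total functional which is linear and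
   continuous on Schwartz functions; its values elsewhere are irrelevant, and
   all the definitions below apply it to Schwartz functions only. *)
Definition tempered T : Prop :=
  (forall (a : R[i]) f g, schwartz f -> schwartz g ->
    T (fun x => a * f x + g x) = a * T f + T g) /\
  (exists (C : R) (N : nat), forall f, schwartz f ->
    ((normc (T f))%:E <= C%:E * schwartz_seminorm N f)%E).

Definition dotrV (x y : 'rV[R]_n) : R := \sum_(i < n) x ord0 i * y ord0 i.

Definition cis (t : R) : R[i] := cos t +i* sin t.

Definition fourier f : 'rV[R]_n -> R[i] := fun xi =>
  cintegral setT (fun x => cis (- dotrV x xi) * f x).

Definition fourier_distr T : ('rV[R]_n -> R[i]) -> R[i] :=
  fun psi => T (fourier psi).

Definition dilate phi (t : R) : 'rV[R]_n -> R[i] := fun x =>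
  (t ^- n)%:C * phi (t^-1 *: x).

Definition convolution phi T : 'rV[R]_n -> R[i] := fun x =>
  T (fun y => phi (x - y)).

Definition maximal phi T : 'rV[R]_n -> \bar R := fun x =>
  ereal_sup [set (normc (convolution (dilate phi t) T x))%:E
            | t in [set t : R | 0 < t]].

Definition cube (a : 'rV[R]_n) (l : R) : set 'rV[R]_n :=
  [set x | forall i, a ord0 i <= x ord0 i <= a ord0 i + l].

Definition morrey_norm (q lambda : R) (g : 'rV[R]_n -> \bar R) : \bar R :=
  ereal_sup [set z | exists (a : 'rV[R]_n) (l : R), 0 < l /\
    z = ((lebesgue_rV R n (cube a l)) `^ (lambda^-1 - q^-1)%R *
         (\int[lebesgue_rV R n]_(y in cube a l) (`|g y| `^ q)) `^ q^-1%R)%E].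

Definition hardy_morrey phi (q lambda : R) T : Prop :=
  tempered T /\ (morrey_norm q lambda (maximal phi T) < +oo)%E.

Definition locally_integrable_on U g : Prop := forall K, compact K -> K `<=` U ->
  (lebesgue_rV R n).-integrable K (fun x => (complex.Re (g x))%:E) /\
  (lebesgue_rV R n).-integrable K (fun x => (complex.Im (g x))%:E).

Definition test_function_on U psi : Prop :=
  [/\ csmooth psi, compact (closure [set x | psi x != 0]) &
      closure [set x | psi x != 0] `<=` U].

(* T coincides on the open set U with the regular distribution given by g. *)
Definition coincides_on U T g : Prop := locally_integrable_on U g /\
  forall psi, test_function_on U psi ->
    T psi = cintegral U (fun x => g x * psi x).

Definition distr_continuous_at T (x0 : 'rV[R]_n) : Prop :=
  exists U g, [/\ open_nbhs x0 U, coincides_on U T g,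
    {for x0, continuous (fun x => complex.Re (g x))} &
    {for x0, continuous (fun x => complex.Im (g x))}].

End distributions.

(* Main.v *)
Require Import Defs.
From mathcomp Require Import all_boot all_order all_algebra.
From mathcomp Require Import all_classical all_reals all_analysis.
From mathcomp Require Import complex.
From mathcomp Require Import measurable_realfun ring lra.

Set Implicit Arguments.
Unset Strict Implicit.
Unset Printing Implicit Defensive.

Import Order.TTheory GRing.Theory Num.Theory.
Import numFieldTopology.Exports numFieldNormedType.Exports.
Import ComplexField.Normc.
Local Open Scope classical_set_scope.
Local Open Scope ring_scope.

(** Put [a = 1 / lambda], so that [0 < a < 1], and let
    [G x = prod_i (1 - |x_i|)_+] be the product of tent functions.  The
    distribution is the lacunary sum
      [f = sum_k c ^ k * G (2 ^ -k * x)]  with  [c = 2 ^ (- n * (1 + a) / 2)].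
    The exponent [(1 + a) / 2] lies strictly between [a] and [1]: the first
    inequality puts [f] into the Hardy-Morrey space, the second one makes its
    Fourier transform unbounded at the origin.

    Size of [f].  A tent is at most [1] and vanishes off [[-1, 1]], so it lies
    below [|u| ^ -a]; hence [G (2 ^ -k * x)] lies below
    [2 ^ (k * n * a) * prod_i |x_i| ^ -a], and [c * 2 ^ (n * a) < 1] makes the
    sum converge to a multiple of [prod_i |x_i| ^ -a].  Averaging at any scale
    [t] preserves this bound up to a constant: a Schwartz function is dominated
    by a product of Cauchy kernels, and the one-dimensional estimate
    [tent_cauchy_kernel_le] is uniform in [t].  So the maximal function is
    dominated by [prod_i |x_i| ^ -a] ([maximal_tent_distr_le]).  The Morrey
    norm of that product factors into one-dimensional integrals of
    [|u| ^ (- a * q)], which is integrable near [0] because [a * q < 1]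
    ([integral_singular_weight_le], [morrey_norm_singular_weight]).

    Fourier transform of [f].  The transform of a tent is
    [2 * (1 - cos xi) / xi ^ 2], which is nonnegative, integrable, and bounded
    below near [0].  Test the transform of [f] against a smooth even cutoff
    [psi] of width [e = 2 ^ -m].  Every term of the series contributes a
    nonnegative amount, and the term [k = m] alone contributes at least
    [c ^ m * b ^ n] for a fixed [b > 0] ([tent_functional_cutoff_lower]).  If
    the transform were near [0] a function continuous at [0], hence bounded by
    some [M] there, the same quantity would be [O(M * (2 * e) ^ n)].  Since
    [c * 2 ^ n > 1], this fails for large [m] ([tent_distr_not_continuous]).

    Every function that has to be integrated is a tensor product, or is
    dominated by one, so that all the estimates reduce to the line through
    [ge0_integral_tensor], [integrable_tensor] and [integral_cos_tensor]. *)

(** * Comparison of integrals *)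

Section integral_comparison.
Context {R : realType}.

(** The integral of a nonnegative function is the supremum over the simple
    functions below it, which is monotone whether or not the functions are
    measurable.  The maximal function is estimated through this comparison. *)
Lemma ge0_le_integral_bound d (T : measurableType d)
    (m : {measure set T -> \bar R}) (D : set T) (f g : T -> \bar R) :
  (forall x, D x -> (0 <= f x)%E) -> (forall x, D x -> (f x <= g x)%E) ->
  (\int[m]_(x in D) f x <= \int[m]_(x in D) g x)%E.
Proof.
move=> f0 fg; have g0 x : D x -> (0 <= g x)%E.
  by move=> Dx; exact: le_trans (f0 _ Dx) (fg _ Dx).
rewrite !ge0_integralE //; apply: ge_ereal_sup => _ [h /= hf <-].
apply: ereal_sup_ubound; exists h => //= x; apply: (le_trans (hf x)).
by rewrite !patchE; case: ifPn => // /set_mem Dx; exact: fg.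
Qed.

Lemma integrable_dominated d (T : measurableType d) (m : {measure set T -> \bar R})
    (f g : T -> R) : measurable_fun setT f -> (forall x, `|f x| <= g x) ->
  m.-integrable setT (EFin \o g) -> m.-integrable setT (EFin \o f).
Proof.
move=> mf fg; apply: le_integrable => //; first exact/measurable_EFinP.
by move=> x _ /=; rewrite lee_fin (le_trans (fg x))// ler_norm.
Qed.

(** The positive and the negative parts of [f] are each bounded by [B], whence
    the factor [2]. *)
Lemma normr_Rintegral_le d (T : measurableType d) (m : {measure set T -> \bar R})
    (D : set T) (f g : T -> R) (B : R) : measurable D ->
  (forall x, D x -> `|f x| <= g x) -> (forall x, 0 <= g x) ->
  (\int[m]_x (g x)%:E <= B%:E)%E -> `|(\int[m]_(x in D) f x)%R| <= 2 * B.
Proof.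
move=> mD fg g0 gB.
have gD : (\int[m]_(x in D) (g x)%:E <= B%:E)%E.
  apply: le_trans gB; rewrite integral_mkcond.
  apply: ge0_le_integral_bound => x _; rewrite /patch; case: ifPn => // _;
    by rewrite lee_fin.
have bnd (s : T -> \bar R) : (forall x, D x -> (0 <= s x <= (g x)%:E)%E) ->
    exists2 b : R, (\int[m]_(x in D) s x)%E = b%:E & 0 <= b <= B.
  move=> s0.
  have s0' x : D x -> (0 <= s x)%E by move=> /s0/andP[].
  have i0 : (0 <= \int[m]_(x in D) s x)%E by exact: integral_ge0.
  have iB : (\int[m]_(x in D) s x <= B%:E)%E.
    by apply: le_trans gD; apply: ge0_le_integral_bound => // x /s0/andP[].
  exists (fine (\int[m]_(x in D) s x)%E); last first.
    by rewrite fine_ge0//= -lee_fin fineK// ge0_fin_numE// (le_lt_trans iB)// ltry.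
  by rewrite fineK// ge0_fin_numE// (le_lt_trans iB)// ltry.
rewrite /Rintegral integralE.
have [b1 -> b1B] : exists2 b : R, (\int[m]_(x in D) (EFin \o f)^\+ x)%E = b%:E &
  0 <= b <= B.
  apply: bnd => x Dx; rewrite funepos_ge0/= funeposE/= -EFin_max lee_fin.
  rewrite ge_max g0 (le_trans _ (fg x Dx)) ?ler_norm//.
have [b2 -> b2B] : exists2 b : R, (\int[m]_(x in D) (EFin \o f)^\- x)%E = b%:E &
  0 <= b <= B.
  apply: bnd => x Dx; rewrite funeneg_ge0/= funenegE/= -EFin_max lee_fin.
  rewrite ge_max g0 (le_trans _ (fg x Dx)) ?ler_normr ?lexx ?orbT//.
rewrite /= ler_norml; move: b1B b2B => /andP[? ?] /andP[? ?]; lra.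
Qed.

End integral_comparison.

(** * The tent function, the Cauchy kernel and the singular power *)

Section line.
Context {R : realType}.
Let mu := @lebesgue_measure R.
Implicit Types (a p s t u v y l : R).

Definition tent u : R := Num.max 0 (1 - `|u|).

Lemma tent_ge0 u : 0 <= tent u.
Proof. by rewrite /tent le_max lexx. Qed.

Lemma tent_le1 u : tent u <= 1.
Proof. by rewrite /tent ge_max ler01 lerBlDr lerDl normr_ge0. Qed.

Lemma tent_eq0 u : 1 <= `|u| -> tent u = 0.
Proof. by move=> u1; apply/max_idPl; rewrite subr_le0. Qed.

Lemma continuous_tent : continuous tent.
Proof.
move=> x; rewrite /tent.
apply: (@continuous_max _ _ (cst 0) (fun u => 1 - `|u|)); first exact: cvg_cst.
by apply: cvgB; [exact: cvg_cst|apply: cvg_norm].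
Qed.

Lemma tent_le_powR a u : 0 <= a -> u != 0 -> tent u <= `|u| `^ (- a).
Proof.
move=> a0 u0; have [u1|u1] := leP 1 `|u|; first by rewrite tent_eq0 ?powR_ge0.
apply: (le_trans (tent_le1 u)); rewrite -(powRr0 `|u|).
by apply: ger_powR; rewrite ?oppr_le0// normr_gt0 u0 ltW.
Qed.

(** [pi] times the Cauchy density of scale [t] centred at [u]. *)
Definition cauchy_kernel t u y : R := t^-1 * (1 + (t^-1 * (y - u)) ^+ 2)^-1.

Lemma cauchy_kernel_ge0 t u y : 0 < t -> 0 <= cauchy_kernel t u y.
Proof. by move=> t0; rewrite mulr_ge0 ?invr_ge0 ?addr_ge0 ?sqr_ge0 ?(ltW t0). Qed.

Lemma measurable_cauchy_kernel t u : measurable_fun setT (cauchy_kernel t u).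
Proof.
apply: continuous_measurable_fun => y; rewrite /cauchy_kernel.
apply: cvgM; first exact: cvg_cst.
apply: cvgV; first by rewrite gt_eqF// ltr_wpDr ?sqr_ge0.
apply: cvgD; first exact: cvg_cst.
have cF : (fun x => t^-1 * (x - u)) @ y --> t^-1 * (y - u).
  by apply: cvgM; [exact: cvg_cst|apply: cvgB; [exact: cvg_id|exact: cvg_cst]].
under eq_fun do rewrite expr2.
by rewrite expr2; exact: cvgM.
Qed.

Lemma integral_cauchy_kernel t u : 0 < t ->
  (\int[mu]_y (cauchy_kernel t u y)%:E = (pi : R)%:E)%E.
Proof.
move=> t0.
have ti0 : 0 < t^-1 by rewrite invr_gt0.
have -> : pi = 2 * (pi / 2) :> R by field.
rewrite EFinM -integral0y_oneDsqr set_itvcy.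
rewrite -ge0_symfun_integralT; first last.
- by move=> x; rewrite /= /oneDsqr sqrrN.
- exact: continuous_oneDsqrV.
- by move=> x; rewrite invr_ge0 addr_ge0 ?sqr_ge0.
pose F := fun y : R => t^-1 * (y - u).
have dF y : is_derive y 1 F t^-1.
  rewrite /F; apply: is_derive_eq.
  by rewrite subr0 /GRing.scale /= mulr1.
have F'E : derive1 F = cst t^-1 by apply/funext => y; rewrite derive1E derive_val.
rewrite (@increasing_ge0_integration_by_substitutionT _ F); first last.
- by move=> x; rewrite invr_ge0 addr_ge0 ?sqr_ge0.
- exact: continuous_oneDsqrV.
- by apply: gt0_cvgMry => //; exact: cvg_addrr.
- by apply: gt0_cvgMrNy => //; exact: cvg_addrr_Ny.
- by move=> x; exact: ex_derive.
- by rewrite F'E; exact: is_cvg_cst.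
- by rewrite F'E; exact: is_cvg_cst.
- by rewrite F'E => x; exact: cvg_cst.
- by move=> x y xy; rewrite /F ltr_pM2l// ltrD2r.
apply: eq_integral => y _; congr EFin.
rewrite F'E [RHS]/(_ * _)/= /cauchy_kernel mulrC; congr (_ * _).
Qed.

Lemma integrable_cauchy_kernel t u : 0 < t ->
  mu.-integrable setT (EFin \o cauchy_kernel t u).
Proof.
move=> t0; apply/integrableP; split.
  by apply/measurable_EFinP; exact: measurable_cauchy_kernel.
under eq_integral do rewrite /= ger0_norm ?cauchy_kernel_ge0//.
by rewrite integral_cauchy_kernel// ltry.
Qed.

(** [|u| ^ -a] off the origin.  A finite value at [0] makes the pointwise bounds
    below hold everywhere; as powers of [0] vanish, it has to be set by hand. *)
Definition singular_weight a u : R := if u == 0 then 1 else `|u| `^ (- a).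

Lemma singular_weight_ge0 a u : 0 <= singular_weight a u.
Proof. by rewrite /singular_weight; case: ifP => // _; exact: powR_ge0. Qed.

Lemma singular_weight_powR a p u : singular_weight a u `^ p =
  singular_weight (a * p) u.
Proof. by rewrite /singular_weight; case: ifP => _;
  rewrite ?powR1// -powRrM mulNr. Qed.

Lemma measurable_singular_weight a : measurable_fun setT (singular_weight a).
Proof.
apply: (@measurable_fun_ifT _ _ (measurableTypeR R) (measurableTypeR R)
    (fun=> 1) (fun u => `|u| `^ (- a)) (fun u => u == 0)).
- exact: measurable_fun_eqr.
- exact: measurable_cst.
- by apply: (measurableT_comp (measurable_powR _)); exact: normr_measurable.
Qed.

Definition itv_ind (b l x : R) : R := \1_`[b, b + l] x.

Lemma itv_ind_ge0 b l u : 0 <= itv_ind b l u.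
Proof. by rewrite /itv_ind indicE. Qed.

Lemma measurable_itv_ind b l : measurable_fun setT (itv_ind b l).
Proof. exact: measurable_indic. Qed.

Lemma integral_itv_ind b l : 0 < l -> (\int[mu]_y (itv_ind b l y)%:E = l%:E)%E.
Proof.
move=> l0; rewrite /itv_ind integral_indic//= setIT /mu lebesgue_measure_itv/=
  lte_fin.
by rewrite ltrDl l0 -EFinB; congr EFin; ring.
Qed.

Lemma integrable_itv_ind (b l : R) : 0 < l ->
  mu.-integrable setT (EFin \o itv_ind b l).
Proof.
move=> l0; apply/integrableP; split; first by apply/measurable_EFinP;
  exact: measurable_itv_ind.
under eq_integral do rewrite /= ger0_norm ?itv_ind_ge0//.
by rewrite integral_itv_ind ?ltry.
Qed.

(** Where [|y| >= |u| / 2] the tent is already at most [(s * |u| / 2) ^ -a] and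
    the kernel has mass [pi]; where [|y| < |u| / 2] the kernel is at most
    [1 / |u|] and the tent lives on an interval of length at most
    [2 * |u| * (s * |u|) ^ -a].  Neither bound involves [t]. *)
Lemma tent_cauchy_kernel_le a s t u : 0 <= a -> a <= 1 -> 0 < s -> s <= 1 ->
  0 < t ->
  (\int[mu]_y (tent (s * y) * cauchy_kernel t u y)%:E <=
    ((2 * pi + 2) * s `^ (- a) * singular_weight a u)%:E)%E.
Proof.
move=> a0 a1 s0 s1 t0.
have sa1 : 1 <= s `^ (- a).
  by rewrite -(powRr0 s); apply: ger_powR; rewrite ?s0 ?oppr_le0.
have pi0 : 0 <= pi :> R by exact: pi_ge0.
have mtc : measurable_fun setT (fun y => (tent (s * y) * cauchy_kernel t u y)%:E).
  apply/measurable_EFinP/measurable_funM; last exact: measurable_cauchy_kernel.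
  apply: measurableT_comp; first exact: continuous_measurable_fun continuous_tent.
  exact: measurable_funM.
have [->|u0] := eqVneq u 0.
  rewrite /singular_weight eqxx mulr1;
    apply: (@le_trans _ _ (\int[mu]_y (cauchy_kernel t 0 y)%:E)%E).
    apply: ge0_le_integral_bound => y _; rewrite lee_fin.
      by rewrite mulr_ge0 ?tent_ge0 ?cauchy_kernel_ge0.
    by rewrite ler_piMl ?tent_le1 ?cauchy_kernel_ge0.
  rewrite integral_cauchy_kernel// lee_fin.
  nra.
rewrite /singular_weight (negPf u0).
have au0 : 0 < `|u| by rewrite normr_gt0.
pose v := s * `|u|; have v0 : 0 < v by rewrite mulr_gt0.
rewrite -mulrA -powRM//; last exact: ltW. rewrite -/v.
(* The half-length of an interval that contains the part of the support of the
   tent where [|y| < |u| / 2]. *)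
pose r := Num.min (`|u| / 2) s^-1.
have r0 : 0 < r by rewrite lt_min divr_gt0//= invr_gt0.
have ru : r / `|u| <= v `^ (- a).
  have [v1|v1] := leP 1 v.
    apply: (@le_trans _ _ (v `^ (- 1))).
      rewrite powR_inv1 ?(ltW v0)// /v invfM ler_pM2r ?invr_gt0// /r ge_min lexx
        orbT//.
    by apply: ler_powR => //; rewrite lerN2.
  apply: (@le_trans _ _ 1).
    rewrite ler_pdivrMr// mul1r /r ge_min; apply/orP; left; lra.
  by rewrite -(powRr0 v); apply: ger_powR; rewrite ?v0 ?(ltW v1)// oppr_le0.
have v2 : (v / 2) `^ (- a) <= 2 * v `^ (- a).
  rewrite powRM ?(ltW v0)// mulrC ler_wpM2r ?powR_ge0//.
  rewrite -powR_inv1// -powRrM mulrNN mul1r; apply: (@le_trans _ _ (2 `^ 1)).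
    by apply: ler_powR => //; lra.
  by rewrite powRr1.
apply: (@le_trans _ _ (\int[mu]_y (((v / 2) `^ (- a) * cauchy_kernel t u y)%:E +
  (`|u|^-1 * itv_ind (- r) (2 * r) y)%:E))%E).
  apply: ge0_le_integral_bound => y _;
    first by rewrite lee_fin mulr_ge0 ?tent_ge0 ?cauchy_kernel_ge0.
  have c0 := cauchy_kernel_ge0 u y t0.
  rewrite -EFinD lee_fin; have [yu|yu] := leP (`|u| / 2) `|y|.
    rewrite ler_wpDr ?mulr_ge0 ?invr_ge0//.
    rewrite ler_wpM2r//.
    have y0 : y != 0 by rewrite -normr_gt0; lra.
    apply: (le_trans (tent_le_powR a0 _)); first by rewrite mulf_neq0// gt_eqF.
    rewrite normrM (gtr0_norm s0) !powRN lef_pV2 ?posrE ?powR_gt0 ?mulr_gt0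
      ?normr_gt0 ?invr_gt0//.
    by apply: ge0_ler_powR => //; rewrite ?nnegrE ?divr_ge0 ?mulr_ge0 ?(ltW s0)//
      /v -mulrA ler_pM2l.
  rewrite ler_wpDl//; first by rewrite mulr_ge0// powR_ge0.
  have cu : cauchy_kernel t u y <= `|u|^-1.
    have yu2 : `|u| / 2 <= `|y - u|.
      rewrite distrC; have := lerB_dist u y; lra.
    rewrite /cauchy_kernel -invfM lef_pV2 ?posrE ?mulr_gt0 ?ltr_wpDr ?sqr_ge0//.
    have -> : t * (1 + (t^-1 * (y - u)) ^+ 2) = t + t^-1 * `|y - u| ^+ 2.
      by rewrite real_normK ?num_real//; field; rewrite gt_eqF.
    have : 0 <= (t - `|y - u|) ^+ 2 / t by rewrite divr_ge0 ?sqr_ge0 ?ltW.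
    rewrite (_ : _ / t = t - 2 * `|y - u| + t^-1 * `|y - u| ^+ 2); last by field;
      rewrite gt_eqF.
    lra.
  rewrite /itv_ind indicE mem_setE in_itv /=.
  have [yr|yr] := boolP (- r <= y <= - r + 2 * r).
    rewrite mulr1 -[leRHS]mul1r ler_pM ?tent_ge0 ?tent_le1//.
  rewrite mulr0 tent_eq0 ?mul0r//.
  have {}yr : r <= `|y|.
    rewrite leNgt; apply: contra yr; rewrite ltr_norml => /andP[]; lra.
  move: yr; rewrite /r minEle; case: ifP => _ yr; first lra.
  by rewrite normrM (gtr0_norm s0) -ler_pdivrMl// mulr1.
rewrite ge0_integralD//=; first last.
- apply/measurable_EFinP/measurable_funM => //; exact: measurable_indic.
- by move=> y _; rewrite lee_fin mulr_ge0 ?invr_ge0.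
- by apply/measurable_EFinP/measurable_funM => //; exact: measurable_cauchy_kernel.
- by move=> y _; rewrite lee_fin mulr_ge0 ?powR_ge0 ?cauchy_kernel_ge0.
under eq_integral do rewrite EFinM.
rewrite ge0_integralZl_EFin ?powR_ge0//; first last.
- by apply/measurable_EFinP; exact: measurable_cauchy_kernel.
- by move=> y _; rewrite lee_fin cauchy_kernel_ge0.
under [X in (_ + X)%E]eq_integral do rewrite EFinM.
rewrite ge0_integralZl_EFin ?invr_ge0//; first last.
- by apply/measurable_EFinP; exact: measurable_indic.
- by move=> y _; rewrite lee_fin.
rewrite integral_cauchy_kernel// integral_itv_ind ?mulr_gt0// -!EFinM -EFinD
  lee_fin.
rewrite [leRHS]mulrDl; apply: lerD.
  rewrite [leRHS]mulrAC; exact: ler_wpM2r.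
by rewrite mulrCA ler_pM2l// mulrC.
Qed.

End line.

Section weight_integral.
Context {R : realType}.
Let mu := @lebesgue_measure R.
Implicit Types (a p s t u v y l : R).

Lemma nneseries_geometric_le (K z : R) : 0 <= K -> 0 < z < 1 ->
  (\big[+%E/0]_(0 <= j <oo) (geometric K z j)%:E <= (K / (1 - z))%:E)%E.
Proof.
move=> K0 /andP[z0 z1]; apply: lime_le.
  by apply: is_cvg_nneseries => j _ _; rewrite lee_fin mulr_ge0// exprn_ge0// ltW.
apply: nearW => N; rewrite sumEFin lee_fin.
by apply: (geometric_le_lim N); rewrite ?ger0_norm// ltW.
Qed.

(** Away from [[-l, l]] the weight is at most [l ^ -p].  Inside, it is dominated
    by a sum over the dyadic intervals [|y| <= l * 2 ^ -j], whose integral is a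
    geometric series of ratio [2 ^ (p - 1) < 1]. *)
Lemma integral_singular_weight_le p : 0 <= p -> p < 1 ->
  exists2 C : R, 0 <= C & forall b l : R, 0 < l ->
  (\int[mu]_y (singular_weight p y * itv_ind b l y)%:E <= (C * l `^ (1 - p))%:E)%E.
Proof.
move=> p0 p1; pose z : R := 2^-1 `^ (1 - p).
have z01 : 0 < z < 1.
  rewrite /z powR_gt0 ?invr_gt0//=.
  have e1 : 1 `^ (1 - p) = 1 :> R by rewrite powR1.
  rewrite -[ltRHS]e1.
  by apply: gt0_ltr_powR; rewrite ?nnegrE ?subr_gt0 ?invf_lt1 ?ltr1n.
have z0 : 0 < z by case/andP: z01.
have z1 : z < 1 by case/andP: z01.
exists (1 + 2 * 2 `^ p / (1 - z)).
  by rewrite addr_ge0 ?mulr_ge0 ?invr_ge0 ?subr_ge0 ?powR_ge0 ?ltW.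
move=> b l l0; pose d j := l * 2^-1 ^+ j.
have d0 j : 0 < d j by rewrite mulr_gt0 ?exprn_gt0 ?invr_gt0.
pose g j y := (d j.+1) `^ (- p) * itv_ind (- d j) (2 * d j) y.
have icc0 b' l' y : 0 <= itv_ind b' l' y by rewrite /itv_ind indicE.
have g0 j y : 0 <= g j y by rewrite mulr_ge0 ?powR_ge0.
have micc b' l' : measurable_fun setT (@itv_ind R b' l') by exact: measurable_indic.
have mg j : measurable_fun setT (g j) by exact: measurable_funM.
have ptw y : ((singular_weight p y * itv_ind b l y)%:E <=
  (l `^ (- p) * itv_ind b l y)%:E +
    \big[+%E/0]_(0 <= j <oo) (g j y)%:E)%E.
  have S0 : (0 <= \big[+%E/0]_(0 <= j <oo) (g j y)%:E)%E.
    by apply: nneseries_ge0 => j _ _; rewrite lee_fin.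
  have w0 := singular_weight_ge0 p y.
  have [ly|yl] := ltP l `|y|.
    have y0 : 0 < `|y| by exact: lt_trans ly.
    rewrite lee_paddr// lee_fin ler_wpM2r// /singular_weight -normr_eq0 gt_eqF//.
    rewrite !powRN lef_pV2 ?posrE ?powR_gt0//.
    by apply: ge0_ler_powR; rewrite ?nnegrE ?(ltW l0) ?(ltW ly).
  rewrite lee_paddl ?lee_fin ?mulr_ge0 ?powR_ge0//.
  (* At [y = 0] no dyadic interval is minimal; any [j] with [l * 2 ^ -(j+1) < 1]
     serves, as the weight is [1] there. *)
  pose m := Num.max `|y| (y == 0)%:R.
  have m0 : 0 < m.
    by rewrite lt_max normr_gt0; case: eqVneq => //=; rewrite ltr01 orbT.
  have exN : exists N, d N.+1 < m.
    have /cvgrPdist_lt/(_ m m0) : geometric l (2^-1 : R) N @[N --> \oo] --> 0.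
      by apply: cvg_geometric; rewrite ger0_norm ?invr_ge0// invf_lt1// ltr1n.
    move=> [N _ /(_ N.+1 (leqnSn N))]; rewrite sub0r normrN => h.
    by exists N; exact: le_lt_trans (ler_norm _) h.
  have [N HN Nmin] := ex_minnP exN.
  have yN : `|y| <= d N.
    case: N HN Nmin => [|k] HN Nmin; first by rewrite /d expr0 mulr1.
    rewrite leNgt; apply/negP => yk; have := Nmin k; rewrite ltnn => H.
    by apply: notF; apply: H; rewrite lt_max yk.
  have gN : singular_weight p y * itv_ind b l y <= g N y.
    rewrite /g (_ : itv_ind (- d N) _ _ = 1); last first.
      rewrite /itv_ind indicE mem_setE in_itv /=.
      move: yN; rewrite ler_norml => /andP[yN1 yN2].
      by rewrite yN1/= (_ : - d N + _ = d N) ?yN2//; ring.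
    rewrite mulr1 -[leRHS]mulr1; apply: ler_pM => //; last first.
      by rewrite /itv_ind indicE; case: (_ \in _).
    move: HN; rewrite /m /singular_weight; case: eqVneq => [->|y0] /=.
      rewrite normr0 lt_max ltNge (ltW (d0 _))/= => dN.
      rewrite -(powRr0 (d N.+1)); apply: ger_powR; rewrite ?oppr_le0// d0//=.
      by rewrite ltW// (lt_trans dN)// ltr01.
    rewrite lt_max (ltNge _ 0) (ltW (d0 _)) orbF => dN.
    have {}y0 : 0 < `|y| by rewrite normr_gt0.
    rewrite !powRN lef_pV2 ?posrE ?powR_gt0//.
    by apply: ge0_ler_powR; rewrite ?nnegrE ?(ltW (d0 _)) ?(ltW dN).
  apply: (@le_trans _ _ (g N y)%:E); first by rewrite lee_fin.
  apply: (le_trans _ (nneseries_lim_ge N.+1 _)) => //; last first.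
    by move=> j _ _; rewrite lee_fin.
  rewrite big_nat_recr//= leeDr// sume_ge0// => j _; by rewrite lee_fin.
apply: (@le_trans _ _ (\int[mu]_y ((l `^ (- p) * itv_ind b l y)%:E +
    \big[+%E/0]_(0 <= j <oo) (g j y)%:E))%E).
  apply: ge0_le_integral_bound => y _; last exact: ptw.
  by rewrite lee_fin mulr_ge0// singular_weight_ge0.
have mgE j : measurable_fun setT (fun y => (g j y)%:E) by exact/measurable_EFinP.
rewrite ge0_integralD//=; first last.
- by apply: ge0_emeasurable_sum => [j y _ _|j _]; [rewrite lee_fin|exact: mgE].
- by move=> y _; apply: nneseries_ge0 => j _ _; rewrite lee_fin.
- apply/measurable_EFinP/measurable_funM; [exact: measurable_cst|exact: micc].
- by move=> y _; rewrite lee_fin mulr_ge0// powR_ge0.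
have Icc c b' l' : 0 <= c -> 0 < l' ->
    (\int[mu]_y (c * itv_ind b' l' y)%:E = (c * l')%:E)%E.
  move=> c0 l'0; under eq_integral do rewrite EFinM.
  rewrite ge0_integralZl_EFin//.
  - by rewrite integral_itv_ind.
  - by move=> y _; rewrite lee_fin.
  - by apply/measurable_EFinP; exact: micc.
rewrite Icc ?powR_ge0// integral_nneseries//; last by move=> j y _; rewrite lee_fin.
under eq_eseriesr do rewrite Icc ?powR_ge0 ?mulr_gt0//.
have E j : (d j.+1) `^ (- p) * (2 * d j) =
  geometric (2 * 2 `^ p * l `^ (1 - p)) z j.
  have -> : d j.+1 = d j * 2^-1 by rewrite /d exprSr mulrA.
  rewrite powRM ?invr_ge0 ?(ltW (d0 _))// -powR_inv1// -(powRrM 2) mulrNN mul1r.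
  have zj : z ^+ j = (2^-1 ^+ j) `^ (1 - p).
    by rewrite /z -!powR_mulrn ?powR_ge0 ?invr_ge0// -!powRrM mulrC.
  rewrite /= zj -[RHS]mulrA -powRM ?exprn_ge0 ?invr_ge0 ?(ltW l0)// -/(d j).
  have dp : d j `^ (1 - p) = d j * d j `^ (- p).
    by rewrite powRD ?(gt_eqF (d0 _)) ?implybT// powRr1// ltW.
  by rewrite dp; ring.
under eq_eseriesr do rewrite E.
apply: (@le_trans _ _ ((l `^ (- p) * l)%:E +
    (2 * 2 `^ p * l `^ (1 - p) / (1 - z))%:E)%E).
  by rewrite leeD2l// nneseries_geometric_le// ?mulr_ge0 ?powR_ge0.
rewrite -EFinD lee_fin.
rewrite (_ : l `^ (- p) * l = l `^ (1 - p)).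
  by rewrite le_eqVlt; apply/orP; left; apply/eqP; set iz := (1 - z)^-1; ring.
by rewrite powRD ?(gt_eqF l0) ?implybT// powRr1 1?mulrC// ltW.
Qed.

End weight_integral.

(** * Tensor products and iterated Lebesgue measure *)

Section tensor.
Context {R : realType}.
Let mu := @lebesgue_measure R.

Definition tensor n (h : 'I_n -> R -> R) (x : 'rV[R]_n) : R :=
  \prod_(i < n) h i (x ord0 i).

Lemma tensor_ge0 n (h : 'I_n -> R -> R) x :
  (forall i u, 0 <= h i u) -> 0 <= tensor h x.
Proof. by move=> h0; apply: prodr_ge0. Qed.

Lemma measurable_coord n (i : 'I_n) :
  measurable_fun [set: 'rV[R]_n] (fun x : 'rV[R]_n => x ord0 i).
Proof.
exact: (measurable_fun_rVP (@id 'rV[R]_n)).1 (@measurable_id _ _ _) i.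
Qed.

Lemma measurable_tensor n (h : 'I_n -> R -> R) :
  (forall i, measurable_fun setT (h i)) -> measurable_fun setT (tensor h).
Proof.
move=> mh; apply: measurable_prod => i _.
by apply: (measurableT_comp (mh i)); exact: measurable_coord.
Qed.

Lemma rV_cons0 n (p : measurableTypeR R * 'rV[R]_n) : rV_cons p ord0 ord0 = p.1.
Proof.
transitivity (@row_mx R 1 1 n (const_mx p.1) p.2 ord0 (lshift n ord0)).
  by congr (fun_of_matrix _ _ _); exact/val_inj.
by rewrite row_mxEl mxE.
Qed.

Lemma rV_consS n (p : measurableTypeR R * 'rV[R]_n) i :
  rV_cons p ord0 (lift ord0 i) = p.2 ord0 i.
Proof.
transitivity (@row_mx R 1 1 n (const_mx p.1) p.2 ord0 (rshift 1 i)).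
  by congr (fun_of_matrix _ _ _); exact/val_inj.
by rewrite row_mxEr.
Qed.

Lemma tensor_cons n (h : 'I_n.+1 -> R -> R) p :
  tensor h (rV_cons p) = h ord0 p.1 * tensor (fun i => h (lift ord0 i)) p.2.
Proof.
rewrite /tensor big_ord_recl rV_cons0; congr (_ * _).
by apply: eq_bigr => i _; rewrite rV_consS.
Qed.

(** One step of Tonelli, along the recursive construction of Lebesgue
    measure on row vectors. *)
Lemma ge0_integral_rV_cons n (G : 'rV[R]_n.+1 -> \bar R) :
  measurable_fun setT G -> (forall x, 0 <= G x)%E ->
  (\int[lebesgue_rV R n.+1]_x G x =
   \int[mu]_u \int[lebesgue_rV R n]_v G (rV_cons (u, v)))%E.
Proof.
move=> mG G0; rewrite [LHS](@ge0_integral_pushforward _ _ _ _ _ _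
  (@measurable_rV_cons R n))//.
rewrite preimage_setT.
rewrite (@fubini_tonelli1 _ _ _ _ _ _ _ (G \o @rV_cons R n))//=.
by apply: measurableT_comp => //; exact: measurable_rV_cons.
Qed.

Lemma integral_rV0 (G : 'rV[R]_0 -> \bar R) : measurable_fun setT G ->
  (\int[lebesgue_rV R 0]_x G x = G 0%R)%E.
Proof. by move=> mG; rewrite [LHS]integral_dirac// diracT mul1e. Qed.

Lemma ge0_integral_tensor n (h : 'I_n -> R -> R) (I : 'I_n -> R) :
  (forall i, measurable_fun setT (h i)) -> (forall i u, 0 <= h i u) ->
  (forall i, \int[mu]_u (h i u)%:E = (I i)%:E)%E ->
  (\int[lebesgue_rV R n]_x (tensor h x)%:E = (\prod_(i < n) I i)%:E)%E.
Proof.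
elim: n => [|n IHn] in h I *; move=> mh h0 hI.
  rewrite integral_rV0; first by rewrite /tensor !big_ord0.
  by apply/measurable_EFinP; exact: measurable_tensor.
have mt := measurable_tensor mh.
rewrite ge0_integral_rV_cons; last 2 first.
- exact/measurable_EFinP.
- by move=> x; rewrite lee_fin tensor_ge0.
have E u : (\int[lebesgue_rV R n]_v (tensor h (rV_cons (u, v)))%:E =
    (h ord0 u)%:E * (\prod_(i < n) I (lift ord0 i))%:E)%E.
  under eq_integral do rewrite tensor_cons EFinM.
  rewrite /= ge0_integralZl_EFin//.
  - by rewrite (IHn _ (fun i => I (lift ord0 i))).
  - by move=> v _; rewrite lee_fin tensor_ge0.
  - apply/measurable_EFinP; apply: (@measurable_tensor n) => i; exact: mh.
under eq_integral do rewrite E.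
rewrite ge0_integralZr//.
- by rewrite hI -EFinM big_ord_recl.
- by apply/measurable_EFinP; exact: mh.
- by move=> u _; rewrite lee_fin.
- rewrite lee_fin; apply: prodr_ge0 => i _; rewrite -lee_fin -hI.
  by apply: integral_ge0 => u _; rewrite lee_fin.
Qed.

Lemma ge0_integral_tensor_le n (h : 'I_n -> R -> R) (I : 'I_n -> R) :
  (forall i, measurable_fun setT (h i)) -> (forall i u, 0 <= h i u) ->
  (forall i, \int[mu]_u (h i u)%:E <= (I i)%:E)%E ->
  (\int[lebesgue_rV R n]_x (tensor h x)%:E <= (\prod_(i < n) I i)%:E)%E.
Proof.
move=> mh h0 hI.
have hi0 i : (0 <= \int[mu]_u (h i u)%:E)%E.
  by apply: integral_ge0 => u _; rewrite lee_fin.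
have hfin i : (\int[mu]_u (h i u)%:E)%E = (fine (\int[mu]_u (h i u)%:E))%:E.
  by rewrite fineK// ge0_fin_numE// (le_lt_trans (hI i))// ltry.
rewrite (ge0_integral_tensor mh h0 hfin) lee_fin; apply: ler_prod => i _.
by rewrite fine_ge0//= -lee_fin -hfin.
Qed.

Lemma integrable_prod d1 d2 (T1 : measurableType d1) (T2 : measurableType d2)
    (m1 : {sigma_finite_measure set T1 -> \bar R})
    (m2 : {sigma_finite_measure set T2 -> \bar R}) (F : T1 -> R) (G : T2 -> R) :
  m1.-integrable setT (EFin \o F) -> m2.-integrable setT (EFin \o G) ->
  (m1 \x m2)%E.-integrable setT (fun p => (F p.1 * G p.2)%:E).
Proof.
move=> iF iG.
have mF := measurable_int _ iF; have mG := measurable_int _ iG.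
have /measurable_EFinP mF' := mF; have /measurable_EFinP mG' := mG.
apply/integrable12ltyP.
  by apply/measurable_EFinP/measurable_funM; apply: measurableT_comp.
have E u : (\int[m2]_v `|(F u * G v)%:E| = `|(F u)%:E| * \int[m2]_v `|(G v)%:E|)%E.
  under eq_integral do rewrite EFinM abseM.
  by rewrite ge0_integralZl//; exact: measurableT_comp.
under eq_integral do rewrite /= E.
rewrite ge0_integralZr//; first last.
- exact: integral_ge0.
- exact: measurableT_comp.
rewrite lte_mul_pinfty//.
- exact: integral_ge0.
- rewrite ge0_fin_numE; last exact: integral_ge0.
  by case/integrableP: iF.
- by case/integrableP: iG.
Qed.

(** One step of Fubini, for a function that separates the first coordinate.
    The hypothesis on [H] is an equation on [rV_cons] so that it also applies
    when [H] is not itself written as a tensor product. *)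
Lemma integral_rV_cons n (F : R -> R) (G : 'rV[R]_n -> R) (H : 'rV[R]_n.+1 -> R) :
  mu.-integrable setT (EFin \o F) ->
  (lebesgue_rV R n).-integrable setT (EFin \o G) ->
  (forall p, H (rV_cons p) = F p.1 * G p.2) ->
  (lebesgue_rV R n.+1).-integrable setT (EFin \o H) /\
  (\int[lebesgue_rV R n.+1]_x H x =
   (\int[mu]_u F u) * (\int[lebesgue_rV R n]_v G v))%R.
Proof.
move=> iF iG HE.
have mF := measurable_int _ iF; have mG := measurable_int _ iG.
have /measurable_EFinP mF' := mF; have /measurable_EFinP mG' := mG.
have mFG : measurable_fun setT (fun p : measurableTypeR R * 'rV[R]_n => F p.1 * G
  p.2).
  by apply: measurable_funM; apply: measurableT_comp.
have mH : measurable_fun setT H.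
  have -> : H = (fun p => F p.1 * G p.2) \o @rV_uncons R n.
    apply/funext => x; rewrite [RHS]/= -(HE (rV_uncons x)); congr (H _).
    apply/rowP => i; case: (unliftP ord0 i) => [j|] ->; last by rewrite rV_cons0.
    by rewrite rV_consS mxE; congr (x _ _); exact/val_inj.
  by apply: measurableT_comp => //; exact: measurable_rV_uncons.
have iFG := integrable_prod iF iG.
have iH : (mu \x lebesgue_rV R n)%E.-integrable (@rV_cons R n @^-1` setT)
    ((EFin \o H) \o @rV_cons R n).
  rewrite preimage_setT; apply: eq_integrable iFG => //.
  by move=> p _; rewrite /= HE.
split.
  apply: (@integrable_pushforward _ _ _ _ _ _ (@measurable_rV_cons R n)) => //.
  exact/measurable_EFinP.
rewrite /Rintegral [X in fine X](@integral_pushforward _ _ _ _ _ _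
  (@measurable_rV_cons R n))//; last exact/measurable_EFinP.
rewrite preimage_setT.
under eq_integral do rewrite /= HE.
rewrite -integral12_prod_meas1//= /fubini_F.
have E u : (\int[lebesgue_rV R n]_v (F u * G v)%:E =
    (F u)%:E * (fine (\int[lebesgue_rV R n]_v (G v)%:E))%:E)%E.
  under eq_integral do rewrite EFinM.
  by rewrite integralZl// fineK//; exact: integrable_fin_num iG.
under eq_integral do rewrite E.
rewrite integralZr// fineM//; exact: integrable_fin_num.
Qed.

End tensor.

(** * Cosine transforms of even tensor products *)

Section cos_tensor.
Context {R : realType}.
Let mu := @lebesgue_measure R.

Lemma integrable_tensor n (h : 'I_n -> R -> R) :
  (forall i, mu.-integrable setT (EFin \o h i)) ->
  (lebesgue_rV R n).-integrable setT (EFin \o tensor h) /\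
  (\int[lebesgue_rV R n]_x tensor h x = \prod_(i < n) \int[mu]_u h i u)%R.
Proof.
elim: n => [|n IHn] in h *; move=> ih.
  have mt : measurable_fun setT (tensor h) by apply: measurable_tensor; case.
  split.
    apply/integrableP; split; first exact/measurable_EFinP.
    by rewrite integral_rV0 ?ltry//; apply/measurableT_comp => //;
      exact/measurable_EFinP.
  rewrite /Rintegral integral_rV0; last exact/measurable_EFinP.
  by rewrite /tensor !big_ord0.
have [it tE] := IHn (fun i => h (lift ord0 i)) (fun i => ih _).
have [iH HE] := integral_rV_cons (ih ord0) it (tensor_cons h).
by split=> //; rewrite HE tE big_ord_recl.
Qed.

Lemma integrable_cosM (f : R -> R) (xi : R) : mu.-integrable setT (EFin \o f) ->
  mu.-integrable setT (EFin \o (fun u => cos (u * xi) * f u)) /\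
  mu.-integrable setT (EFin \o (fun u => sin (u * xi) * f u)).
Proof.
move=> fi; have /measurable_EFinP mf := measurable_int _ fi.
have fin := integrable_norm fi.
have mM : measurable_fun setT (fun u : R => u * xi) by exact: measurable_funM.
split; apply: integrable_dominated fin.
- apply: measurable_funM => //.
  by apply: measurableT_comp mM; apply: continuous_measurable_fun;
    exact: continuous_cos.
- by move=> u; rewrite normrM ler_piMl// ler_norml cos_geN1 cos_le1.
- apply: measurable_funM => //.
  by apply: measurableT_comp mM; apply: continuous_measurable_fun;
    exact: continuous_sin.
- by move=> u; rewrite normrM ler_piMl// ler_norml sin_geN1 sin_le1.
Qed.

Lemma Rintegral_odd (f : R -> R) : mu.-integrable setT (EFin \o f) ->
  (forall u, f (- u) = - f u) -> (\int[mu]_u f u)%R = 0.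
Proof.
move=> fi fodd; have mf := measurable_int _ fi.
have mN : measurable_fun setT (-%R : measurableTypeR R -> measurableTypeR R).
  by apply: measurable_funN; exact: measurable_id.
have H : (\int[mu]_u f u)%R = (\int[mu]_u f (- u))%R.
  rewrite /Rintegral; congr fine.
  transitivity (\int[pushforward mu
    (-%R : measurableTypeR R -> measurableTypeR R)]_u (f u)%:E)%E.
    by apply: eq_measure_integral => //= A mA _; exact/esym/lebesgue_measureN.
  rewrite (integral_pushforward mN)//.
  rewrite preimage_setT.
  rewrite (_ : _ \o _ = EFin \o (fun u => - f u)); last first.
    by apply/funext => u /=; rewrite fodd.
  by have := integrableN fi; apply: eq_integrable.
move: H; under [X in _ = X -> _]eq_Rintegral do rewrite fodd -mulN1r.
rewrite RintegralZl// mulN1r => /eqP;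
  rewrite -subr_eq0 opprK -mulr2n mulrn_eq0/= => /eqP//.
Qed.

(** Evenness in each coordinate kills every sine: in the expansion of
    [cos (x . xi)] by the addition formula, only the product of the cosines
    has a nonzero integral.  The induction needs the sine integral as well. *)
Lemma integral_cos_tensor n (h : 'I_n -> R -> R) (xi : 'rV[R]_n) :
  (forall i, mu.-integrable setT (EFin \o h i)) ->
  (forall i u, h i (- u) = h i u) ->
  [/\ (lebesgue_rV R n).-integrable setT
        (EFin \o (fun x => cos (dotrV x xi) * tensor h x)),
      (lebesgue_rV R n).-integrable setT
        (EFin \o (fun x => sin (dotrV x xi) * tensor h x)),
      (\int[lebesgue_rV R n]_x (cos (dotrV x xi) * tensor h x) =
        \prod_(i < n) \int[mu]_u (cos (u * xi ord0 i) * h i u))%R &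
      (\int[lebesgue_rV R n]_x (sin (dotrV x xi) * tensor h x) = 0)%R].
Proof.
elim: n => [|n IHn] in h xi *; move=> ih hE.
  have [it tE] := integrable_tensor ih.
  have d0 x : dotrV x xi = 0 by rewrite /dotrV big_ord0.
  have c0 : (fun x => cos (dotrV x xi) * tensor h x) = tensor h.
    by apply/funext => x; rewrite d0 cos0 mul1r.
  have s0 : (fun x => sin (dotrV x xi) * tensor h x) = cst 0.
    by apply/funext => x; rewrite d0 sin0 mul0r.
  rewrite c0 s0; split => //; first exact: integrable0.
    by rewrite tE !big_ord0.
  by rewrite /Rintegral integral0.
pose xi' : 'rV[R]_n := \row_i xi ord0 (lift ord0 i).
pose h' i := h (lift ord0 i).
have [ic isn cE sE] := IHn h' xi' (fun i => ih _) (fun i => hE _).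
have [icF isF] := integrable_cosM (xi ord0 ord0) (ih ord0).
have sF0 : (\int[mu]_u (sin (u * xi ord0 ord0) * h ord0 u) = 0)%R.
  by apply: Rintegral_odd => // u; rewrite mulNr sinN hE mulNr.
have dE (p : measurableTypeR R * 'rV[R]_n) :
    dotrV (rV_cons p) xi = p.1 * xi ord0 ord0 + dotrV p.2 xi'.
  rewrite /dotrV big_ord_recl rV_cons0; congr (_ + _).
  by apply: eq_bigr => i _; rewrite rV_consS mxE.
pose mk (F : R -> R) (G : 'rV[R]_n -> R) (x : 'rV[R]_n.+1) : R :=
  F (rV_uncons x).1 * G (rV_uncons x).2.
have mkE F G p : mk F G (rV_cons p) = F p.1 * G p.2 by rewrite /mk rV_consK.
have [i1 e1] := integral_rV_cons icF ic (mkE _ _).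
have [i2 e2] := integral_rV_cons isF isn (mkE _ _).
have [i3 e3] := integral_rV_cons icF isn (mkE _ _).
have [i4 e4] := integral_rV_cons isF ic (mkE _ _).
have surj (x : 'rV[R]_n.+1) : exists p, x = rV_cons p.
  exists (rV_uncons x); apply/rowP => i.
  case: (unliftP ord0 i) => [j|] ->; last by rewrite rV_cons0.
  by rewrite rV_consS mxE; congr (x _ _); exact/val_inj.
have CE : (fun x => cos (dotrV x xi) * tensor h x) = (fun x =>
    mk (fun u => cos (u * xi ord0 ord0) * h ord0 u)
       (fun x => cos (dotrV x xi') * tensor h' x) x -
    mk (fun u => sin (u * xi ord0 ord0) * h ord0 u)
       (fun x => sin (dotrV x xi') * tensor h' x) x).
  apply/funext => x; have [p ->] := surj x.
  by rewrite !mkE dE tensor_cons cosD /h'; ring.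
have SE : (fun x => sin (dotrV x xi) * tensor h x) = (fun x =>
    mk (fun u => sin (u * xi ord0 ord0) * h ord0 u)
       (fun x => cos (dotrV x xi') * tensor h' x) x +
    mk (fun u => cos (u * xi ord0 ord0) * h ord0 u)
       (fun x => sin (dotrV x xi') * tensor h' x) x).
  apply/funext => x; have [p ->] := surj x.
  by rewrite !mkE dE tensor_cons sinD /h'; ring.
rewrite CE SE; split.
- have := integrableB measurableT i1 i2; apply: eq_integrable => // x _ /=.
- have := integrableD measurableT i4 i3; apply: eq_integrable => // x _ /=.
- rewrite RintegralB// e1 e2 sE mulr0 subr0 cE big_ord_recl; congr (_ * _).
  by apply: eq_bigr => i _; rewrite mxE.
- by rewrite RintegralD// e4 e3 sE sF0 mulr0 mul0r addr0.
Qed.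

End cos_tensor.

(** * Borel sets of row vectors *)

Section measurability_rV.
Context {R : realType} {n : nat}.

(** The sigma-algebra generated by the coordinates is the Borel one: an open
    set is the countable union of the rational cubes that it contains. *)
Lemma open_measurable_rV (U : set 'rV[R]_n) : open U -> measurable U.
Proof.
move=> oU; pose r k : R := k.+1%:R^-1.
pose box (p : 'rV[rat]_n * nat) : set 'rV[R]_n :=
  \bigcap_(i in [set: 'I_n]) [set x | `|x ord0 i - ratr (p.1 ord0 i)| < r p.2].
have mbox p : measurable (box p).
  apply: fin_bigcap_measurable => [|i _]; first exact: finite_finset.
  rewrite [X in measurable X](_ : _ =
      (fun x : 'rV[R]_n => x ord0 i) @^-1`
      `](ratr (p.1 ord0 i) - r p.2), (ratr (p.1 ord0 i) + r p.2)[).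
    by rewrite -[X in measurable X]setTI; exact: measurable_coord.
  by apply/seteqP; split => x /=; rewrite in_itv/= ltr_distl.
have -> : U = \bigcup_(p in [set: {p : 'rV[rat]_n * nat | `[< box p `<=` U >]}])
  box (val p).
  apply/seteqP; split => x; last by move=> [[p /= /asboolP pU] _]; exact: pU.
  move=> Ux; have /nbhs_ballP[e /= e0 eU] : nbhs x U by exact: open_nbhs_nbhs.
  have [k ke] : exists k, r k < e / 2.
    have [k /= kH] := @ltr_add_invr R 0 (e / 2) ltac:(by rewrite divr_gt0).
    by exists k; rewrite add0r in kH.
  have rk0 : 0 < r k by rewrite invr_gt0.
  have ex i : exists q : rat, ratr q \in `](x ord0 i - r k), (x ord0 i + r k)[.
    by apply: rat_in_itvoo; rewrite ltrD2l; lra.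
  pose q : 'rV[rat]_n := \row_i xchoose (ex i).
  have qP i : `|x ord0 i - ratr (q ord0 i)| < r k.
    have := xchooseP (ex i); rewrite mxE in_itv/= ltr_distl => /andP[]; lra.
  have bU : `[< box (q, k) `<=` U >].
    apply/asboolP => y yb; apply: eU; split=> // i j; rewrite (ord1 i).
    have := yb j I; rewrite /= distrC => yj.
    rewrite /ball /= (le_lt_trans (ler_distD (ratr (q ord0 j)) _ _))//.
    have := qP j; lra.
  by exists (exist _ (q, k) bU) => // i _; exact: qP.
apply: countable_bigcupT_measurable => [|p]; last exact: mbox.
exact: countableP.
Qed.

Lemma continuous_measurable_rV (f : 'rV[R]_n -> R) :
  continuous f -> measurable_fun setT f.
Proof.
move=> /continuousP cf; apply: (measurability _ (RGenOpens.measurableE R)).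
move=> _ [_ [a [b ->] <-]]; rewrite setTI; apply: open_measurable_rV.
exact/cf/interval_open.
Qed.

End measurability_rV.

(** * The distribution: a lacunary sum of dilated tent products *)

Section functional.
Context {R : realType}.
Let mu := @lebesgue_measure R.

Lemma geometric_series_bound (u : R^nat) (K z : R) : 0 < z < 1 ->
  (forall k, `|u k| <= K * z ^+ k) ->
  cvgn (series u) /\ `|limn (series u)| <= K / (1 - z).
Proof.
move=> /andP[z0 z1] uK.
have K0 : 0 <= K by have := le_trans (normr_ge0 _) (uK 0); rewrite expr0 mulr1.
have z1' : `|z| < 1 by rewrite ger0_norm// ltW.
have cg := @is_cvg_geometric_series R K z z1'.
have cn : cvgn [normed series u].
  apply: (@series_le_cvg _ _ (geometric K z)) => //= k.
  by rewrite mulr_ge0// exprn_ge0// ltW.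
split; first exact: normed_cvg.
apply: (le_trans (lim_series_norm cn)).
have <- : limn (series (geometric K z)) = K / (1 - z).
  by apply/cvg_lim => //; exact: cvg_geometric_series.
exact: lim_series_le.
Qed.

Definition dyadic_tent n k (x : 'rV[R]_n) : R :=
  tensor (fun=> fun u => tent (2^-1 ^+ k * u)) x.

Definition tent_pairing n k (u : 'rV[R]_n -> R) : R :=
  \int[lebesgue_rV R n]_x (dyadic_tent k x * u x).

(** The ratio [c] of the lacunary sum. *)
Definition tent_coef n (a : R) : R := (2^-1 `^ ((1 + a) / 2)) ^+ n.

(** The sum over [k] is kept outside the integrals: each term pairs an integrable
    function with [u], so that the Fourier transform of the distribution can be
    computed term by term although the sum itself is not integrable. *)
Definition tent_functional n (a : R) (u : 'rV[R]_n -> R) : R :=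
  limn (series (fun k => tent_coef n a ^+ k * tent_pairing k u)).

Definition tent_distr n (a : R) (f : 'rV[R]_n -> R[i]) : R[i] :=
  (tent_functional a (fun x => complex.Re (f x)) +i*
   tent_functional a (fun x => complex.Im (f x)))%C.

Lemma dyadic_tent_ge0 n k (x : 'rV[R]_n) : 0 <= dyadic_tent k x.
Proof. by apply: tensor_ge0 => i u; exact: tent_ge0. Qed.

Lemma dyadic_tent_le1 n k (x : 'rV[R]_n) : dyadic_tent k x <= 1.
Proof.
by apply: prodr_ile1 => i _; rewrite tent_ge0 tent_le1.
Qed.

Lemma measurable_tent_dilate k : measurable_fun setT
  (fun u : R => tent (2^-1 ^+ k * u)).
Proof.
apply: measurableT_comp; first exact: continuous_measurable_fun continuous_tent.
exact: measurable_funM.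
Qed.

Lemma measurable_dyadic_tent n k : measurable_fun setT (@dyadic_tent n k).
Proof. by apply: measurable_tensor => i; exact: measurable_tent_dilate. Qed.

Lemma tensorM n (h g : 'I_n -> R -> R) x :
  tensor h x * tensor g x = tensor (fun i u => h i u * g i u) x.
Proof. by rewrite /tensor -big_split. Qed.

(** A pointwise bound by a tensor product is all that is kept of [u], so that the
    estimate factors over the coordinates. *)
Lemma tent_pairing_bound n k (u : 'rV[R]_n -> R) (D : R)
    (kap : 'I_n -> R -> R) (I : 'I_n -> R) : 0 <= D ->
  (forall i, measurable_fun setT (kap i)) -> (forall i v, 0 <= kap i v) ->
  (forall x, `|u x| <= D * tensor kap x) ->
  (forall i, \int[mu]_v (tent (2^-1 ^+ k * v) * kap i v)%:E <= (I i)%:E)%E ->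
  `|tent_pairing k u| <= 2 * (D * \prod_(i < n) I i).
Proof.
move=> D0 mk k0 uD Ik.
have mt i : measurable_fun setT (fun v : R => tent (2^-1 ^+ k * v) * kap i v).
  by apply: measurable_funM; [exact: measurable_tent_dilate|exact: mk].
have t0 i v : 0 <= tent (2^-1 ^+ k * v) * kap i v by rewrite mulr_ge0// tent_ge0.
apply: (normr_Rintegral_le (g := fun x => D * tensor
  (fun i (v : R) => tent (2^-1 ^+ k * v) * kap i v) x)) => //.
- move=> x _; rewrite normrM (ger0_norm (dyadic_tent_ge0 _ _)) -tensorM mulrCA.
  by apply: ler_wpM2l (uD x); exact: dyadic_tent_ge0.
- by move=> x; rewrite mulr_ge0// tensor_ge0.
- under eq_integral do rewrite EFinM.
  rewrite ge0_integralZl_EFin//; last 2 first.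
  + by move=> x _; rewrite lee_fin tensor_ge0.
  + by apply/measurable_EFinP; exact: measurable_tensor.
  by rewrite EFinM lee_wpmul2l// ge0_integral_tensor_le.
Qed.

(** The decay of Schwartz functions that is used: a tensor product that is
    integrable. *)
Definition cauchy_dominated n (u : 'rV[R]_n -> R) (D : R) :=
  forall x, `|u x| <= D * tensor (fun=> cauchy_kernel 1 0) x.

Lemma cauchy_dominated_ge0 n (u : 'rV[R]_n -> R) D : cauchy_dominated u D -> 0 <= D.
Proof.
move=> /(_ 0) uD; have := le_trans (normr_ge0 _) uD.
rewrite pmulr_lge0// /tensor; apply: prodr_gt0 => i _.
by rewrite mulr_gt0 ?invr_gt0// ltr_wpDr ?sqr_ge0.
Qed.

Lemma cauchy_dominated_pairing n (u : 'rV[R]_n -> R) D k : cauchy_dominated u D ->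
  `|tent_pairing k u| <= 2 * (D * pi ^+ n).
Proof.
move=> uD; rewrite -{2}(card_ord n) -prodr_const.
apply: tent_pairing_bound (cauchy_dominated_ge0 uD) _ _ uD _.
- by move=> i; exact: measurable_cauchy_kernel.
- by move=> i v; exact: cauchy_kernel_ge0.
- move=> i; rewrite -(@integral_cauchy_kernel R 1 0)//.
  apply: ge0_le_integral_bound => v _; rewrite lee_fin.
    by rewrite mulr_ge0 ?tent_ge0 ?cauchy_kernel_ge0.
  by rewrite ler_piMl ?tent_le1 ?cauchy_kernel_ge0.
Qed.

Lemma cauchy_dominated_integrable n (u : 'rV[R]_n -> R) D k :
  measurable_fun setT u -> cauchy_dominated u D ->
  (lebesgue_rV R n).-integrable setT (EFin \o (fun x => dyadic_tent k x * u x)).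
Proof.
move=> mu_ uD; have D0 := cauchy_dominated_ge0 uD.
apply: (@integrable_dominated _ _ _ _ _
  (fun x => D * tensor (fun=> cauchy_kernel 1 0) x)).
- by apply: measurable_funM => //; exact: measurable_dyadic_tent.
- move=> x; rewrite normrM (ger0_norm (dyadic_tent_ge0 _ _)) (le_trans _ (uD x))//.
  by rewrite ler_piMl// dyadic_tent_le1.
- have ic := @integrable_cauchy_kernel R 1 0 ltr01.
  have [it _] := integrable_tensor (fun _ : 'I_n => ic).
  by have := integrableZl measurableT D it; apply: eq_integrable.
Qed.

Lemma tent_coef_bound n a : 0 < a -> (0 < n)%N -> 0 < tent_coef n a < 1.
Proof.
move=> a0 n0; have g0 : 0 < 2^-1 `^ ((1 + a) / 2) :> R by rewrite powR_gt0
  ?invr_gt0.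
rewrite /tent_coef exprn_gt0//= exprn_ilt1 ?(ltW g0)// -?lt0n//.
have e1 : 1 `^ ((1 + a) / 2) = 1 :> R by rewrite powR1.
rewrite -[ltRHS]e1; apply: gt0_ltr_powR; rewrite ?nnegrE ?invf_lt1 ?ltr1n//; lra.
Qed.

Lemma tent_functional_bound n a (u : 'rV[R]_n -> R) D : 0 < a -> (0 < n)%N ->
  cauchy_dominated u D ->
  cvgn (series (fun k => tent_coef n a ^+ k * tent_pairing k u)) /\
  `|tent_functional a u| <= 2 * (D * pi ^+ n) / (1 - tent_coef n a).
Proof.
move=> a0 n0 uD; have /andP[c0 c1] := tent_coef_bound a0 n0.
apply: geometric_series_bound => [|k]; first exact/andP.
rewrite normrM ger0_norm ?exprn_ge0 ?(ltW c0)// mulrC ler_wpM2r ?exprn_ge0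
  ?(ltW c0)//.
exact: cauchy_dominated_pairing.
Qed.

Lemma tent_functional_lin n a (r : R) (u v : 'rV[R]_n -> R) D E :
  0 < a -> (0 < n)%N ->
  measurable_fun setT u -> cauchy_dominated u D -> measurable_fun setT v ->
    cauchy_dominated v E ->
  tent_functional a (fun x => r * u x + v x) =
  r * tent_functional a u + tent_functional a v.
Proof.
move=> a0 n0 mu_ uD mv vE.
have [cu _] := tent_functional_bound a0 n0 uD.
have [cv _] := tent_functional_bound a0 n0 vE.
rewrite /tent_functional -[r * _]/(r *: _) -lim_seriesZ// -lim_seriesD//;
  last first.
  exact: is_cvg_seriesZ.
congr (limn (series _)); apply/funext => k.
rewrite [RHS]/(r * (_ * _) + _ * _) [X in _ = X + _]mulrCA -[RHS]mulrDr.
congr (_ * _).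
have iu := cauchy_dominated_integrable k mu_ uD;
  have iv := cauchy_dominated_integrable k mv vE.
rewrite /tent_pairing -RintegralZl// -RintegralD//; last first.
  by have := integrableZl measurableT r iu; apply: eq_integrable.
by apply: eq_Rintegral => x _; ring.
Qed.

End functional.

(** * Temperedness *)

Section tempered_part.
Context {R : realType}.

Lemma normcE (z : R[i]) :
  normc z = Num.sqrt (complex.Re z ^+ 2 + complex.Im z ^+ 2).
Proof. by case: z. Qed.

Lemma Re_le_normc (z : R[i]) : `|complex.Re z| <= normc z.
Proof. by rewrite normcE -sqrtr_sqr ler_wsqrtr// lerDl sqr_ge0. Qed.

Lemma Im_le_normc (z : R[i]) : `|complex.Im z| <= normc z.
Proof. by rewrite normcE -sqrtr_sqr ler_wsqrtr// lerDr sqr_ge0. Qed.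

Lemma normc_le (z : R[i]) : normc z <= `|complex.Re z| + `|complex.Im z|.
Proof.
rewrite normcE -[leRHS]ger0_norm ?addr_ge0// -sqrtr_sqr ler_wsqrtr//.
rewrite sqrrD !real_normK ?num_real//.
by rewrite (addrAC (_ ^+ 2)) lerDl mulrn_wge0// mulr_ge0.
Qed.

Lemma normc_ge0 (z : R[i]) : 0 <= normc z.
Proof. exact: le_trans (normr_ge0 _) (Re_le_normc z). Qed.

Lemma coord_le_norm n (x : 'rV[R]_n) i : `|x ord0 i| <= `|x|.
Proof.
rewrite [leRHS]mx_normrE.
exact: (le_bigmax 0 (fun ij : 'I_1 * 'I_n => `|x ij.1 ij.2|) (ord0, i)).
Qed.

(** The seminorm of order [2 * n] suffices, since
    [prod_i (1 + x_i ^ 2) <= (1 + |x|) ^ (2 * n)] for the sup norm. *)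
Lemma schwartz_decay n (f : 'rV[R]_n -> R[i]) : schwartz f ->
  exists2 S : R, schwartz_seminorm (2 * n) f = S%:E &
    forall x, normc (f x) <= S * tensor (fun=> cauchy_kernel 1 0) x.
Proof.
move=> [_ /(_ (2 * n)%N) fin].
have le_sn x : (((1 + `|x|) ^+ (2 * n) * normc (f x))%:E <=
    schwartz_seminorm (2 * n) f)%E.
  by apply: ereal_sup_ubound; exists [::], x.
have sn0 : (0 <= schwartz_seminorm (2 * n) f)%E.
  by apply: le_trans (le_sn 0); rewrite lee_fin mulr_ge0 ?normc_ge0//.
exists (fine (schwartz_seminorm (2 * n) f)).
  by rewrite fineK// ge0_fin_numE.
move=> x; have := le_sn x.
rewrite -[X in (_ <= X)%E]fineK ?ge0_fin_numE// lee_fin => H.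
have t0 : 0 <= tensor (fun=> cauchy_kernel 1 0) x.
  by apply: tensor_ge0 => i u; exact: cauchy_kernel_ge0.
apply: le_trans (ler_wpM2r t0 H); rewrite mulrAC ler_peMl ?normc_ge0//.
rewrite exprM -[X in _ ^+ X](card_ord n) -prodr_const -big_split/=.
apply: (big_ind (fun y => 1 <= y)) => // [y1 y2|i _]; first exact: mulr_ege1.
rewrite /cauchy_kernel invr1 !mul1r subr0 ler_pdivlMr ?mul1r; last first.
  by rewrite ltr_wpDr ?sqr_ge0.
have h1 := coord_le_norm x i; have h0 := normr_ge0 (x ord0 i).
rewrite -[x ord0 i ^+ 2]real_normK ?num_real//.
nra.
Qed.

Lemma schwartz_cauchy_dominated n (f : 'rV[R]_n -> R[i]) : schwartz f ->
  exists S : R, [/\ schwartz_seminorm (2 * n) f = S%:E,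
    cauchy_dominated (fun x => complex.Re (f x)) S,
    cauchy_dominated (fun x => complex.Im (f x)) S,
    measurable_fun setT (fun x => complex.Re (f x)) &
    measurable_fun setT (fun x => complex.Im (f x))].
Proof.
move=> sf; have [S SE Sf] := schwartz_decay sf; exists S; split => //.
- by move=> x; exact: le_trans (Re_le_normc _) (Sf x).
- by move=> x; exact: le_trans (Im_le_normc _) (Sf x).
- apply: continuous_measurable_rV => x; apply: differentiable_continuous.
  by have [] := sf.1 [::] x.
- apply: continuous_measurable_rV => x; apply: differentiable_continuous.
  by have [] := sf.1 [::] x.
Qed.

Lemma cauchy_dominatedZ n (u : 'rV[R]_n -> R) D r : cauchy_dominated u D ->
  cauchy_dominated (fun x => r * u x) (`|r| * D).
Proof. by move=> uD x; rewrite normrM -mulrA ler_wpM2l. Qed.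

Lemma cauchy_dominatedD n (u v : 'rV[R]_n -> R) D E : cauchy_dominated u D ->
  cauchy_dominated v E ->
  cauchy_dominated (fun x => u x + v x) (D + E).
Proof.
by move=> uD vE x; rewrite mulrDl (le_trans (ler_normD _ _))// lerD.
Qed.

Lemma tempered_tent_distr n a : 0 < a -> (0 < n)%N ->
  tempered (tent_distr a : ('rV[R]_n -> R[i]) -> R[i]).
Proof.
move=> a0 n0; split.
  move=> [r s] f g /schwartz_cauchy_dominated[D [_ fr fi mfr mfi]].
  move=> /schwartz_cauchy_dominated[E [_ gr gi mgr mgi]].
  have lin u v D' E' mu_ uD mv vE c :=
    @tent_functional_lin R n a c u v D' E' a0 n0 mu_ uD mv vE.
  rewrite /tent_distr.
  have -> : (fun x => complex.Re ((r +i* s)%C * f x + g x)) =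
      (fun x => r * complex.Re (f x) +
        ((- s) * complex.Im (f x) + complex.Re (g x))).
    by apply/funext => x; case: (f x) (g x) => [? ?] [? ?] /=; ring.
  have -> : (fun x => complex.Im ((r +i* s)%C * f x + g x)) =
      (fun x => r * complex.Im (f x) + (s * complex.Re (f x) + complex.Im (g x))).
    by apply/funext => x; case: (f x) (g x) => [? ?] [? ?] /=; ring.
  have m1 : measurable_fun setT (fun x => - s * complex.Im (f x) + complex.Re
    (g x)).
    by apply: measurable_funD => //; exact: measurable_funM.
  have m2 : measurable_fun setT (fun x => s * complex.Re (f x) + complex.Im (g x)).
    by apply: measurable_funD => //; exact: measurable_funM.
  rewrite (lin _ _ _ _ mfr fr m1 (cauchy_dominatedD (cauchy_dominatedZ (- s) fi)
    gr)).
  rewrite (lin _ _ _ _ mfi fi m2 (cauchy_dominatedD (cauchy_dominatedZ s fr) gi)).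
  rewrite (lin _ _ _ _ mfi fi mgr gr) (lin _ _ _ _ mfr fr mgi gi).
  by apply/eqP; rewrite eq_complex/=; apply/andP; split; apply/eqP; ring.
exists (2 * (2 * pi ^+ n / (1 - tent_coef n a))), (2 * n)%N => f sf.
have [S [-> fr fi mfr mfi]] := schwartz_cauchy_dominated sf.
rewrite -EFinM lee_fin; apply: (le_trans (normc_le _)) => /=.
have [_ br] := tent_functional_bound a0 n0 fr.
have [_ bi] := tent_functional_bound a0 n0 fi.
apply: (le_trans (lerD br bi)); rewrite le_eqVlt; apply/orP; left; apply/eqP.
by set c := _^-1; ring.
Qed.

End tempered_part.

(** * Membership in the Hardy-Morrey space *)

Section hardy_morrey_part.
Context {R : realType}.

Lemma normc_scale (r : R) (z : R[i]) : 0 <= r -> normc (r%:C%C * z) = r * normc z.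
Proof.
by move=> r0; rewrite normcM normcE/= expr0n addr0 sqrtr_sqr ger0_norm.
Qed.

Lemma tensor_cauchy_kernel_dilate n (t : R) (x y : 'rV[R]_n) : 0 < t ->
  t ^- n * tensor (fun=> cauchy_kernel 1 0) (t^-1 *: (x - y)) =
  tensor (fun i => cauchy_kernel t (x ord0 i)) y.
Proof.
move=> t0; rewrite -exprVn -[X in _ ^+ X](card_ord n) -prodr_const -big_split/=.
apply: eq_bigr => i _; rewrite /cauchy_kernel !mxE invr1 !mul1r subr0;
  congr (_ * _).
by rewrite -sqrrN -mulrN opprB.
Qed.

Lemma dilate_decay n (phi : 'rV[R]_n -> R[i]) (S t : R) x y : 0 < t ->
  (forall z, normc (phi z) <= S * tensor (fun=> cauchy_kernel 1 0) z) ->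
  normc (dilate phi t (x - y)) <= S * tensor
    (fun i => cauchy_kernel t (x ord0 i)) y.
Proof.
move=> t0 phiS; have tn : 0 <= t ^- n by rewrite invr_ge0 exprn_ge0// ltW.
rewrite /dilate normc_scale// -tensor_cauchy_kernel_dilate// mulrCA.
exact: ler_wpM2l.
Qed.

(** The ratio is [z = 2 ^ (- n * (1 - a) / 2)]. *)
Lemma tent_coef_scale n a : 0 < a -> a < 1 -> (0 < n)%N ->
  exists2 z : R, 0 < z < 1 & forall k,
    tent_coef n a ^+ k * ((2^-1 ^+ k) `^ (- a)) ^+ n = z ^+ k.
Proof.
move=> a0 a1 n0; pose r : R := 2^-1 `^ ((1 - a) / 2).
have r0 : 0 < r by rewrite powR_gt0 ?invr_gt0.
have r1 : r < 1.
  have e1 : 1 `^ ((1 - a) / 2) = 1 :> R by rewrite powR1.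
  rewrite -[ltRHS]e1; apply: gt0_ltr_powR; rewrite ?nnegrE ?invf_lt1 ?ltr1n//; lra.
exists (r ^+ n); first by rewrite exprn_gt0//= exprn_ilt1 ?(ltW r0)// -lt0n.
move=> k; have -> : (2^-1 ^+ k) `^ (- a) = (2^-1 `^ (- a)) ^+ k :> R.
  by rewrite -!powR_mulrn ?powR_ge0 ?invr_ge0// -!powRrM mulrC.
rewrite -exprM mulnC exprM -exprMn /tent_coef -exprMn; congr (_ ^+ _ ^+ _).
rewrite -powRD; last by rewrite invr_eq0 pnatr_eq0 implybT.
by rewrite /r; congr (_ `^ _); field.
Qed.

(** For each [t] and [k] the pairing with a dilate of [phi] factors over the
    coordinates, and [tent_cauchy_kernel_le] bounds each factor independently
    of [t]; the series in [k] is then geometric by [tent_coef_scale]. *)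
Lemma maximal_tent_distr_le n a (phi : 'rV[R]_n -> R[i]) : 0 < a -> a < 1 ->
  (0 < n)%N ->
  schwartz phi ->
  exists2 C : R, 0 <= C & forall x,
    (0 <= maximal phi (tent_distr a) x <=
      (C * tensor (fun=> singular_weight a) x)%:E)%E.
Proof.
move=> a0 a1 n0 sphi; have [S _ phiS] := schwartz_decay sphi.
have [z z01 zE] := tent_coef_scale a0 a1 n0.
have /andP[c0 c1] := tent_coef_bound a0 n0.
have S0 : 0 <= S.
  apply: (@cauchy_dominated_ge0 _ _ (fun x : 'rV[R]_n => complex.Re (phi x))) => x.
  exact: le_trans (Re_le_normc _) (phiS x).
have pi0 : 0 <= pi :> R by exact: pi_ge0.
pose K := 2 * S * (2 * pi + 2) ^+ n / (1 - z).
have z1 : 0 < 1 - z by move: z01 => /andP[]; lra.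
have K0 : 0 <= K.
  have p2 : 0 <= 2 * pi + 2 :> R by lra.
  by rewrite divr_ge0 ?(ltW z1)// mulr_ge0 ?exprn_ge0// mulr_ge0.
exists (2 * K) => [|x]; first by rewrite mulr_ge0.
have W0 : 0 <= tensor (fun=> singular_weight a) x by apply: tensor_ge0 => i u;
  exact: singular_weight_ge0.
have bnd t (u : 'rV[R]_n -> R) : 0 < t ->
    (forall y, `|u y| <= normc (dilate phi t (x - y))) ->
    `|tent_functional a u| <= K * tensor (fun=> singular_weight a) x.
  move=> t0 uphi.
  have pk k : `|tent_pairing k u| <=
      2 * (S * \prod_(i < n) ((2 * pi + 2) * (2^-1 ^+ k) `^ (- a) *
        singular_weight a (x ord0 i))).
    apply: (@tent_pairing_bound _ n k u S (fun i => cauchy_kernel t (x ord0 i)))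
      => //.
    - by move=> i; exact: measurable_cauchy_kernel.
    - by move=> i v; exact: cauchy_kernel_ge0.
    - by move=> y; apply: le_trans (uphi y) (dilate_decay x y t0 phiS).
    - move=> i; apply: tent_cauchy_kernel_le => //; try exact: ltW.
      by rewrite exprn_ile1// ?invr_ge0// invf_le1// ler1n.
  have [_] : cvgn (series (fun k => tent_coef n a ^+ k * tent_pairing k u)) /\
      `|tent_functional a u| <=
      (2 * S * (2 * pi + 2) ^+ n * tensor (fun=> singular_weight a) x) / (1 - z).
    apply: geometric_series_bound => // k.
    rewrite normrM ger0_norm ?exprn_ge0 ?(ltW c0)// -zE.
    apply: (le_trans (ler_wpM2l _ (pk k))); first by rewrite exprn_ge0// ltW.
    rewrite big_split big_split/= !prodr_const !card_ord
      -/(tensor (fun=> singular_weight a) x).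
    by rewrite le_eqVlt; apply/orP; left; apply/eqP; ring.
  by rewrite /K mulrAC.
apply/andP; split.
  apply: (@le_trans _ _ (normc (convolution (dilate phi 1) (tent_distr a) x))%:E).
    by rewrite lee_fin normc_ge0.
  by apply: ereal_sup_ubound; exists 1 => //=; exact: ltr01.
apply: ge_ereal_sup => _ [t t0 <-]; rewrite lee_fin.
apply: (le_trans (normc_le _)); rewrite -mulrA mulr2n mulrDl !mul1r.
apply: lerD; apply: (bnd t) => // y; [exact: Re_le_normc|exact: Im_le_normc].
Qed.

Lemma cubeE n (b : 'rV[R]_n) l x :
  \1_(cube b l) x = tensor (fun i => itv_ind (b ord0 i) l) x :> R.
Proof.
rewrite indicE; have [xb|xb] := boolP (x \in cube b l).
  rewrite /tensor big1// => i _; rewrite /itv_ind indicE mem_setE in_itv/=.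
  by move/set_mem : xb => ->.
have : ~ cube b l x by move=> H; move: xb; rewrite mem_set.
move=> /existsNP[i /negP xi]; rewrite /tensor (bigD1 i)//=.
by rewrite /itv_ind indicE mem_setE in_itv/= (negPf xi) mul0r.
Qed.

Lemma measurable_cube n (b : 'rV[R]_n) l : measurable (cube b l).
Proof.
have -> : cube b l = \bigcap_(i in [set: 'I_n])
    ((fun x : 'rV[R]_n => x ord0 i) @^-1` `[b ord0 i, b ord0 i + l]).
  apply/seteqP; split => x xb i; first by move=> _ /=; rewrite in_itv/=; exact: xb.
  by have := xb i I; rewrite /= in_itv.
apply: fin_bigcap_measurable => [|i _]; first exact: finite_finset.
by rewrite -[X in measurable X]setTI; exact: measurable_coord.
Qed.

Lemma lebesgue_cube n (b : 'rV[R]_n) l : 0 < l ->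
  lebesgue_rV R n (cube b l) = (l ^+ n)%:E.
Proof.
move=> l0; have mc := measurable_cube b l.
rewrite -[X in lebesgue_rV R n X]setIT -integral_indic//.
under eq_integral do rewrite cubeE.
rewrite (ge0_integral_tensor _ _ (fun i => integral_itv_ind (b ord0 i) l0)).
- by rewrite prodr_const card_ord.
- by move=> i; exact: measurable_itv_ind.
- by move=> i u; exact: itv_ind_ge0.
Qed.

(** The integral over a cube of side [l] is at most a constant times
    [l ^ (n * (1 - a * q))]; raised to [1 / q] and multiplied by
    [l ^ (n * (a - 1 / q))], the powers of [l] cancel. *)
Lemma morrey_norm_singular_weight n q a (g : 'rV[R]_n -> \bar R) (C : R) :
  0 < q -> 0 < a -> a * q < 1 -> 0 <= C ->
  (forall x, 0 <= g x <= (C * tensor (fun=> singular_weight a) x)%:E)%E ->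
  (morrey_norm q a^-1 g < +oo)%E.
Proof.
move=> q0 a0 aq C0 gC.
have [C' C'0 HC'] := integral_singular_weight_le (ltW (mulr_gt0 a0 q0)) aq.
apply: (@le_lt_trans _ _ (C * C' `^ (n%:R / q))%:E); last exact: ltry.
apply: ge_ereal_sup => _ [b [l [l0 ->]]].
rewrite lebesgue_cube// invrK.
pose J := C `^ q * (C' * l `^ (1 - a * q)) ^+ n.
have J0 : 0 <= J by rewrite mulr_ge0 ?powR_ge0// exprn_ge0// mulr_ge0// powR_ge0.
have IJ : (\int[lebesgue_rV R n]_(y in cube b l) (`|g y| `^ q) <= J%:E)%E.
  rewrite integral_mkcond.
  have mw i : measurable_fun setT (fun v : R => singular_weight (a * q) v *
    itv_ind (b ord0 i) l v).
    by apply: measurable_funM; [exact: measurable_singular_weight|exact: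
      measurable_itv_ind].
  have w0 i v : 0 <= singular_weight (a * q) v * itv_ind (b ord0 i) l v.
    by rewrite mulr_ge0 ?singular_weight_ge0 ?itv_ind_ge0.
  pose h := tensor (fun i (v : R) => singular_weight (a * q) v * itv_ind
    (b ord0 i) l v).
  have h0 x : 0 <= h x by exact: tensor_ge0.
  apply: (@le_trans _ _ (\int[lebesgue_rV R n]_y ((C `^ q)%:E * (h y)%:E))%E).
    apply: ge0_le_integral_bound => y _; rewrite patchE.
      by case: ifPn => // _; exact: poweR_ge0.
    case: ifPn => [yb|_]; last by rewrite -EFinM lee_fin mulr_ge0 ?powR_ge0.
    have -> : h y = tensor (fun=> singular_weight a) y `^ q.
      rewrite /h -tensorM -cubeE indicE yb mulr1 /tensor.
      have : forall s : seq 'I_n, (\prod_(i <- s) singular_weight a (y ord0 i))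
        `^ q =
          \prod_(i <- s) singular_weight (a * q) (y ord0 i).
        elim=> [|i s IH]; first by rewrite !big_nil powR1.
        by rewrite !big_cons powRM ?singular_weight_ge0 ?prodr_ge0 ?IH
          ?singular_weight_powR// => j _; exact: singular_weight_ge0.
      by move=> ->.
    have W0 : 0 <= tensor (fun=> singular_weight a) y by apply: tensor_ge0 => i u;
      exact: singular_weight_ge0.
    rewrite -EFinM -powRM// -poweR_EFin.
    have /andP[g0 gle] := gC y.
    rewrite gee0_abs//.
    apply: gt0_ler_poweR => //; first exact: ltW.
    by rewrite in_itv/= leey g0. by rewrite in_itv/= leey lee_fin mulr_ge0.
  rewrite ge0_integralZl_EFin ?powR_ge0//; last 2 first.
  - by move=> y _; rewrite lee_fin.
  - by apply/measurable_EFinP; exact: measurable_tensor.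
  rewrite EFinM lee_wpmul2l ?lee_fin ?powR_ge0//.
  rewrite -[X in _ ^+ X](card_ord n) -prodr_const.
  apply: ge0_integral_tensor_le => // i; exact: HC'.
have -> : (C * C' `^ (n%:R / q))%:E =
    ((l ^+ n)%:E `^ (a - q^-1) * J%:E `^ q^-1)%E.
  rewrite !poweR_EFin -EFinM; congr EFin.
  have l'0 := ltW l0.
  rewrite /J powRM ?powR_ge0 ?exprn_ge0 ?mulr_ge0 ?powR_ge0//.
  rewrite -powRrM divff ?gt_eqF// powRr1//.
  rewrite exprMn powRM ?exprn_ge0 ?powR_ge0//.
  have -> : (l ^+ n) `^ (a - q^-1) = l `^ (n%:R * (a - q^-1)).
    by rewrite -powR_mulrn// -powRrM.
  have -> : (C' ^+ n) `^ q^-1 = C' `^ (n%:R / q).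
    by rewrite -powR_mulrn// -powRrM.
  have -> : (l `^ (1 - a * q) ^+ n) `^ q^-1 = l `^ (- (n%:R * (a - q^-1))).
    rewrite -powR_mulrn ?powR_ge0// -!powRrM; congr (_ `^ _).
    by field; rewrite gt_eqF.
  have lE : l `^ (n%:R * (a - q^-1)) * l `^ (- (n%:R * (a - q^-1))) = 1.
    by rewrite powRN divff// gt_eqF// powR_gt0.
  rewrite -[LHS]mulr1 -[X in _ * X = _]lE; ring.
apply: lee_wpmul2l; first exact: poweR_ge0.
apply: gt0_ler_poweR => //; first by rewrite invr_ge0 ltW.
- by rewrite in_itv/= leey andbT; apply: integral_ge0 => y _; exact: poweR_ge0.
- by rewrite in_itv/= leey andbT lee_fin.
Qed.

Lemma hardy_morrey_tent_distr n q lambda (phi : 'rV[R]_n -> R[i]) :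
  (0 < n)%N -> 0 < q -> q <= 1 -> 1 < lambda -> schwartz phi ->
  hardy_morrey phi q lambda (tent_distr lambda^-1).
Proof.
move=> n0 q0 q1 l1 sphi.
have l0 : 0 < lambda by lra.
have a0 : 0 < lambda^-1 by rewrite invr_gt0.
have a1 : lambda^-1 < 1 by rewrite invf_lt1.
split; first exact: tempered_tent_distr.
have [C C0 HC] := maximal_tent_distr_le a0 a1 n0 sphi.
rewrite -[X in morrey_norm _ X]invrK; apply: morrey_norm_singular_weight HC => //.
nra.
Qed.

End hardy_morrey_part.

(** * Fourier transform of the tent *)

Section tent_transform.
Context {R : realType}.
Let mu := @lebesgue_measure R.

Lemma integral_affine_cos (al be v p q : R) : p < q -> v != 0 ->
  (\int[mu]_(u in `[p, q]) ((al + be * u) * cos (u * v)) =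
   ((al + be * q) * sin (q * v) / v + be * cos (q * v) / v ^+ 2) -
   ((al + be * p) * sin (p * v) / v + be * cos (p * v) / v ^+ 2))%R.
Proof.
move=> pq v0.
pose F (u : R) : R := (al + be * u) * sin (u * v) / v + be * cos (u * v) / v ^+ 2.
pose f (u : R) : R := (al + be * u) * cos (u * v).
have dF (u : R) : is_derive u 1 F (f u).
  rewrite /F /f; apply: is_derive_eq.
  by rewrite /GRing.scale /=; field.
have cf : continuous f.
  by move=> ?; apply/differentiable_continuous/derivable1_diffP; exact: ex_derive.
have E : (\int[mu]_(u in `[p, q]) (f u)%:E = (F q)%:E - (F p)%:E)%E; last first.
  by rewrite /Rintegral E.
rewrite (@continuous_FTC2 _ f F)//.
- exact: continuous_subspaceT.
- have cF : continuous F.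
    by move=> ?; apply/differentiable_continuous/derivable1_diffP; exact: ex_derive.
  split=> [w _||]; first exact: ex_derive.
    by apply: cvg_at_right_filter; exact: cF.
  by apply: cvg_at_left_filter; exact: cF.
- by move=> w _; rewrite derive1E derive_val.
Qed.

Lemma tent_support (s u : R) : 0 < s -> u \notin `[- s^-1, s^-1] ->
  tent (s * u) = 0.
Proof.
move=> s0; rewrite in_itv/= -ler_norml -ltNge => su.
by rewrite tent_eq0// normrM gtr0_norm// -ler_pdivrMl// mulr1 ltW.
Qed.

Lemma Rintegral_support (f : R -> R) (p q : R) :
  (forall u, u \notin `[p, q] -> f u = 0) ->
  (\int[mu]_u f u = \int[mu]_(u in `[p, q]) f u)%R.
Proof.
move=> f0; rewrite /Rintegral; congr fine; rewrite [RHS]integral_mkcond.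
apply: eq_integral => u _; rewrite patchE; case: ifPn => // up.
by rewrite f0//; apply: contra up => up; rewrite inE.
Qed.

Lemma integrable_tent (s : R) : 0 < s ->
  mu.-integrable setT (EFin \o (fun u => tent (s * u))).
Proof.
move=> s0; have ii : mu.-integrable setT (EFin \o itv_ind (- s^-1) (2 * s^-1)).
  by apply: integrable_itv_ind; rewrite mulr_gt0 ?invr_gt0.
apply: integrable_dominated ii.
  apply: measurableT_comp; first exact: continuous_measurable_fun continuous_tent.
  exact: measurable_funM.
move=> u; rewrite ger0_norm ?tent_ge0//.
have [us|us] := boolP (u \in `[- s^-1, s^-1]); last first.
  by rewrite tent_support// /itv_ind indicE.
rewrite /itv_ind indicE mem_setE (_ : - s^-1 + 2 * s^-1 = s^-1); last by ring.
by rewrite us tent_le1.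
Qed.

Definition tent_fourier (s v : R) : R := \int[mu]_u (cos (u * v) * tent (s * u)).

Lemma tent_fourierE (s v : R) : 0 < s -> v != 0 ->
  tent_fourier s v = 2 * s * (1 - cos (s^-1 * v)) / v ^+ 2.
Proof.
move=> s0 v0; have si0 : 0 < s^-1 by rewrite invr_gt0.
rewrite /tent_fourier (@Rintegral_support _ (- s^-1) s^-1); last first.
  by move=> u us; rewrite tent_support// mulr0.
have [ic _] := integrable_cosM v (integrable_tent s0).
have ics (A : set R) : measurable A ->
    mu.-integrable A (EFin \o (fun u => cos (u * v) * tent (s * u))).
  by move=> mA; apply: integrableS ic.
have := @Rintegral_itvB _ (fun u => cos (u * v) * tent (s * u))
  (BLeft (- s^-1)) (BRight s^-1) 0.
rewrite Rintegral_itv_obnd_cbnd; last exact: ics.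
move=> /(_ (ics _ _)) -/(_ ltac:(done)); rewrite !bnd_simp.
rewrite oppr_le0 (ltW si0) => /(_ isT isT)/eqP; rewrite subr_eq => /eqP ->.
have -> : \int[mu]_(u in `[0, s^-1]) (cos (u * v) * tent (s * u)) =
    \int[mu]_(u in `[0, s^-1]) ((1 + (- s) * u) * cos (u * v)).
  apply: eq_Rintegral => u; rewrite inE/= in_itv/= => /andP[u0 us].
  have su0 : 0 <= s * u by rewrite mulr_ge0// ltW.
  rewrite mulrC; congr (_ * _); rewrite /tent (ger0_norm su0) mulNr.
  by apply/max_idPr; rewrite subr_ge0 -ler_pdivlMl// mulr1.
have -> : \int[mu]_(u in `[- s^-1, 0]) (cos (u * v) * tent (s * u)) =
    \int[mu]_(u in `[- s^-1, 0]) ((1 + s * u) * cos (u * v)).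
  apply: eq_Rintegral => u; rewrite inE/= in_itv/= => /andP[u0 us].
  have su0 : s * u <= 0 by rewrite mulr_ge0_le0// ltW.
  rewrite mulrC; congr (_ * _); rewrite /tent (ler0_norm su0) opprK.
  by apply/max_idPr; rewrite -lerBlDl sub0r mulrC -ler_pdivrMr// mulN1r.
rewrite !integral_affine_cos ?oppr_lt0//.
rewrite !mul0r sin0 cos0 !mulNr sinN cosN divff ?gt_eqF//.
field; rewrite v0 gt_eqF//.
Qed.

Lemma tent_fourier_ge0 (s v : R) : 0 < s -> 0 <= tent_fourier s v.
Proof.
move=> s0; have [->|v0] := eqVneq v 0.
  by apply: Rintegral_ge0 => u _; rewrite mulr0 cos0 mul1r tent_ge0.
rewrite tent_fourierE// divr_ge0 ?sqr_ge0// mulr_ge0 ?subr_ge0 ?cos_le1//.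
by rewrite mulr_ge0// ltW.
Qed.

(** Integrability of the transform, uniformly in the scale: near the origin the
    transform is at most the length [2 / s] of the support, far from it the
    explicit formula gives [4 * s / v ^ 2]. *)
Lemma tent_fourier_le (s v : R) : 0 < s ->
  tent_fourier s v <= 8 * cauchy_kernel s 0 v.
Proof.
move=> s0.
have cE : cauchy_kernel s 0 v = s / (s ^+ 2 + v ^+ 2).
  rewrite /cauchy_kernel subr0; field; rewrite !gt_eqF//; nra.
have D0 : 0 < s ^+ 2 + v ^+ 2 by rewrite ltr_pwDl ?sqr_ge0// exprn_gt0.
rewrite cE mulrA ler_pdivlMr//.
have [vs|vs] := leP (v ^+ 2) (s ^+ 2).
  have H : tent_fourier s v <= 2 / s.
    have [ic _] := integrable_cosM v (integrable_tent s0).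
    have i2 : (\int[mu]_u (itv_ind (- s^-1) (2 * s^-1) u)%:E = (2 * s^-1)%:E)%E.
      by rewrite integral_itv_ind// mulr_gt0// invr_gt0.
    have -> : 2 / s = (\int[mu]_u itv_ind (- s^-1) (2 * s^-1) u)%R by rewrite
      /Rintegral i2.
    apply: le_Rintegral => //.
      by apply: integrable_itv_ind; rewrite mulr_gt0 ?invr_gt0.
    move=> u _; have [us|us] := boolP (u \in `[- s^-1, s^-1]); last first.
      by rewrite tent_support// mulr0 /itv_ind indicE.
    rewrite /itv_ind indicE mem_setE (_ : - s^-1 + 2 * s^-1 = s^-1); last by ring.
    rewrite us -[leRHS]mul1r; apply: (@le_trans _ _ (1 * tent (s * u))).
      by rewrite ler_wpM2r ?tent_ge0// cos_le1.
    by rewrite ler_wpM2l ?tent_le1.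
  apply: (le_trans (ler_wpM2r (ltW D0) H)).
  rewrite mulrAC ler_pdivrMr//; nra.
have v0 : v != 0 by rewrite -sqrf_eq0 gt_eqF// (le_lt_trans (sqr_ge0 s)).
rewrite tent_fourierE// mulrAC ler_pdivrMr ?exprn_even_gt0//.
have c1 := cos_geN1 (s^-1 * v); have c2 := cos_le1 (s^-1 * v).
apply: (@le_trans _ _ (2 * s * 2 * (s ^+ 2 + v ^+ 2))).
  rewrite ler_wpM2r ?(ltW D0)// ler_wpM2l//; last lra.
  by rewrite mulr_ge0// ltW.
nra.
Qed.

(** For [|v| <= s] the phase [u * v] stays in [[-1, 1]] on the support of the
    tent, so the cosine is at least [cos 1]; and the tent is at least [1 / 2] on
    an interval of length [1 / s]. *)
Lemma tent_fourier_lower (s v : R) : 0 < s -> `|v| <= s ->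
  cos 1 / 2 / s <= tent_fourier s v.
Proof.
move=> s0 vs; have [ic _] := integrable_cosM v (integrable_tent s0).
have c0 := cos1_gt0 R.
pose h u := cos 1 / 2 * itv_ind (- (2 * s)^-1) s^-1 u.
have si0 : 0 < s^-1 by rewrite invr_gt0.
have i2 : (\int[mu]_u (h u)%:E = (cos 1 / 2 / s)%:E)%E.
  under eq_integral do rewrite EFinM.
  rewrite ge0_integralZl_EFin//.
  - by rewrite integral_itv_ind.
  - by move=> u _; rewrite lee_fin /itv_ind indicE.
  - by apply/measurable_EFinP; exact: measurable_indic.
  - by rewrite divr_ge0// ltW.
have h0 u : 0 <= h u by rewrite mulr_ge0 ?divr_ge0 ?(ltW c0)// /itv_ind indicE.
have -> : cos 1 / 2 / s = (\int[mu]_u h u)%R by rewrite /Rintegral i2.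
apply: le_Rintegral => //.
  apply/integrableP; split.
    apply/measurable_EFinP; apply: measurable_funM => //; exact: measurable_indic.
  under eq_integral do rewrite /= ger0_norm//.
  by rewrite i2 ltry.
move=> u _; have cosu : `|u| <= s^-1 -> cos 1 <= cos (u * v).
  move=> us; rewrite -(cos_norm (u * v)); have uv1 : `|u * v| <= 1.
    by rewrite normrM (le_trans (ler_pM _ _ us vs))// mulVf// gt_eqF.
  have p2 := pi_ge2 R.
  move: uv1; rewrite le_eqVlt => /predU1P[->//|uv1]; apply: ltW.
  by rewrite ltr_cos// in_itv/=; apply/andP; split=> //; lra.
rewrite /h /itv_ind indicE mem_setE in_itv/=; have [ui|ui] := boolP (_ && _).
  have us : `|u| <= (2 * s)^-1.
    rewrite ler_norml; move: ui; rewrite invfM => /andP[-> h2] /=; lra.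
  have us' : `|u| <= s^-1 by apply: (le_trans us); rewrite invfM; lra.
  rewrite mulr1; apply: ler_pM => //; first exact: ltW.
    exact: cosu.
  rewrite /tent le_max; apply/orP; right.
  have : s * `|u| <= 2^-1 by rewrite -ler_pdivlMl// mulrC -invfM.
  by rewrite normrM (gtr0_norm s0); lra.
rewrite mulr0; have [us|us] := boolP (u \in `[- s^-1, s^-1]); last first.
  by rewrite tent_support// mulr0.
rewrite mulr_ge0 ?tent_ge0// (le_trans (ltW c0))// cosu//.
by move: us; rewrite in_itv/= -ler_norml.
Qed.

End tent_transform.

Section cos_fubini.
Context {R : realType}.
Let mu := @lebesgue_measure R.

(** The Fourier transform is self-adjoint. *)
Lemma fubini_cos (f g : R -> R) :
  mu.-integrable setT (EFin \o f) -> mu.-integrable setT (EFin \o g) ->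
  mu.-integrable setT (EFin \o (fun u => g u * \int[mu]_v (cos (v * u) * f v)))%R /\
  (\int[mu]_u (g u * \int[mu]_v (cos (v * u) * f v)) =
   \int[mu]_v (f v * \int[mu]_u (cos (u * v) * g u)))%R.
Proof.
move=> fi gi; have /measurable_EFinP mf := measurable_int _ fi.
have /measurable_EFinP mg := measurable_int _ gi.
pose H (p : measurableTypeR R * measurableTypeR R) : R :=
  cos (p.2 * p.1) * (g p.1 * f p.2).
have igf := integrable_prod gi fi.
have mH : measurable_fun setT H.
  apply: measurable_funM.
    apply: measurableT_comp.
      by apply: continuous_measurable_fun; exact: continuous_cos.
    by apply: measurable_funM; [exact: measurable_snd|exact: measurable_fst].
  apply: measurable_funM.
    by apply: measurableT_comp => //; exact: measurable_fst.
  by apply: measurableT_comp => //; exact: measurable_snd.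
have iH : (mu \x mu)%E.-integrable setT (EFin \o H).
  apply: (integrable_dominated mH _ (integrable_norm igf)) => p.
  by rewrite /H normrM ler_piMl// cos_max.
have E1 u : (\int[mu]_v (H (u, v))%:E)%E =
  (g u * \int[mu]_v (cos (v * u) * f v))%:E.
  have [ic _] := integrable_cosM u fi.
  rewrite EFinM fineK; last exact: integrable_fin_num.
  rewrite -integralZl//.
  by apply: eq_integral => v _; rewrite -EFinM; congr EFin; rewrite /H/=; ring.
have E2 v : (\int[mu]_u (H (u, v))%:E)%E =
  (f v * \int[mu]_u (cos (u * v) * g u))%:E.
  have [ic _] := integrable_cosM v gi.
  rewrite EFinM fineK; last exact: integrable_fin_num.
  rewrite -integralZl//.
  by apply: eq_integral => u _; rewrite -EFinM; congr EFin;
    rewrite /H/= (mulrC u); ring.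
split.
  by apply: eq_integrable (integrable_fubini_F iH) => // u _;
    rewrite /= /fubini_F/= E1.
rewrite /Rintegral; congr fine.
transitivity (\int[mu]_u \int[mu]_v (H (u, v))%:E)%E.
  by apply: eq_integral => u _; rewrite E1.
rewrite (Fubini iH).
by apply: eq_integral => v _; rewrite E2.
Qed.

(** By [fubini_cos] the integral is that of [f] against the nonnegative transform
    of the tent.  The upper bound does not depend on [s], which makes the series
    over the scales converge; the lower bound only uses [|v| <= s / 2], where
    [f] is at least [kappa] and the transform is of order [1 / s]. *)
Lemma tent_cos_pairing (s kappa : R) (f : R -> R) : 0 < s -> 0 <= kappa ->
  mu.-integrable setT (EFin \o f) -> (forall v, 0 <= f v <= 1) ->
  (forall v, `|v| <= s / 2 -> kappa <= f v) ->
  let F u : R := tent (s * u) * \int[mu]_v (cos (v * u) * f v) in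
  mu.-integrable setT (EFin \o F) /\
  kappa * cos 1 / 2 <= (\int[mu]_u F u)%R <= 8 * pi.
Proof.
move=> s0 k0 fi f01 fk F; rewrite /F.
have [iF ->] := fubini_cos fi (integrable_tent s0); split=> //.
have [iT _] := fubini_cos (integrable_tent s0) fi.
have f0 v : 0 <= f v by have /andP[] := f01 v.
have f1 v : f v <= 1 by have /andP[] := f01 v.
have ic := @integrable_cauchy_kernel R s 0 s0.
have c0 := cos1_gt0 R.
apply/andP; split.
  pose b := kappa * (cos 1 / 2 / s).
  have b0 : 0 <= b by rewrite mulr_ge0// divr_ge0 ?divr_ge0// ltW.
  have ii := integrable_itv_ind (- (s / 2)) s0.
  have -> : kappa * cos 1 / 2 = (\int[mu]_v (b * itv_ind (- (s / 2)) s v))%R.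
    rewrite RintegralZl// /Rintegral integral_itv_ind//= /b.
    by field; rewrite gt_eqF.
  apply: le_Rintegral => //.
    by have := integrableZl measurableT b ii; apply: eq_integrable.
  move=> v _; rewrite /itv_ind indicE mem_setE in_itv/=;
    have [vs|vs] := boolP (_ && _).
    have vs' : `|v| <= s / 2 by rewrite ler_norml; move: vs => /andP[-> ?] /=; lra.
    rewrite mulr1; apply: ler_pM => //; first by rewrite !divr_ge0// ltW.
      exact: fk.
    by apply: tent_fourier_lower => //; apply: (le_trans vs'); lra.
  by rewrite mulr0 mulr_ge0//; exact: tent_fourier_ge0.
have -> : 8 * pi = (\int[mu]_v (8 * cauchy_kernel s 0 v))%R :> R.
  by rewrite RintegralZl// /Rintegral integral_cauchy_kernel.
apply: le_Rintegral => //.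
  by have := integrableZl measurableT (8 : R) ic; apply: eq_integrable.
move=> v _; rewrite -[leRHS]mul1r; apply: ler_pM => //.
  exact: tent_fourier_ge0.
exact: tent_fourier_le.
Qed.

End cos_fubini.

(** * Smooth cutoffs *)

Section smooth_line.
Context {R : realType}.
Implicit Types u v : R -> R.

(** Carrying the derivative as a witness lets the closure properties be proved by
    induction, without computing iterated derivatives. *)
Fixpoint smooth_upto k (u : R -> R) : Prop :=
  if k is k'.+1 then
    exists2 u' : R -> R,
      forall x : R, is_derive x (1 : R) u (u' x) & smooth_upto k' u'
  else True.

Lemma smooth_uptoW k u : smooth_upto k.+1 u -> smooth_upto k u.
Proof. by elim: k u => //= k IH u [u' du su']; exists u' => //; exact: IH. Qed.

Lemma smooth_upto_cst k (c : R) : smooth_upto k (fun=> c).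
Proof.
by elim: k c => //= k IH c; exists (fun=> 0) => // x; exact: is_derive_cst.
Qed.

Lemma smooth_uptoD k u v : smooth_upto k u -> smooth_upto k v ->
  smooth_upto k (fun x => u x + v x).
Proof.
elim: k u v => //= k IH u v [u' du su'] [v' dv sv'].
exists (fun x => u' x + v' x) => [x|]; last exact: IH.
exact: is_deriveD.
Qed.

Lemma smooth_uptoM k u v : smooth_upto k u -> smooth_upto k v ->
  smooth_upto k (fun x => u x * v x).
Proof.
elim: k u v => // k IH u v su sv.
have su0 := smooth_uptoW su; have sv0 := smooth_uptoW sv.
case: su sv => u' du su' [v' dv sv'].
exists (fun x => u x * v' x + v x * u' x) => [x|].
  exact: is_deriveM.
by apply: smooth_uptoD; exact: IH.
Qed.

Lemma smooth_upto_affine k u (a b : R) : smooth_upto k u ->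
  smooth_upto k (fun x => u (a * x + b)).
Proof.
elim: k u => // k IH u [u' du su'].
exists (fun x => u' (a * x + b) * a) => [x|].
  apply: (@is_derive1_comp _ u (fun x => a * x + b)).
  by apply: is_derive_eq; rewrite addr0 /GRing.scale/= mulr1.
by apply: smooth_uptoM; [exact: IH|exact: smooth_upto_cst].
Qed.

Definition smooth (u : R -> R) := forall k, smooth_upto k u.

Lemma smooth_derive u : smooth u ->
  smooth (derive1 u) /\ forall x : R, is_derive x (1 : R) u (derive1 u x).
Proof.
move=> su; have dE v : (exists2 u' : R -> R,
    forall x : R, is_derive x (1 : R) u (u' x) & v = u') -> v = derive1 u.
  by move=> [u' du ->]; apply/funext => x; rewrite derive1E derive_val.
split=> [k|x].
  by have [u' du su'] := su k.+1; rewrite -(dE u')//; exists u'.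
by have [u' du _] := su 1; rewrite -(dE u')//; exists u'.
Qed.

(** For [j = 0] the classical flat function [exp (- 1 / t)].  The factor [t ^ -j]
    makes the family stable under differentiation up to linear combinations
    ([is_derive_flat_exp]), which gives smoothness by induction. *)
Definition flat_exp (j : nat) (t : R) : R :=
  if 0 < t then (t^-1) ^+ j * expR (- t^-1) else 0.

(** The exponential [exp (1 / t)] dominates the term [t ^ -(j + 1) / (j + 1)!] of
    its series. *)
Lemma flat_exp_le (j : nat) (t : R) : 0 <= t -> flat_exp j t <= (j.+1)`!%:R * t.
Proof.
move=> t0; rewrite /flat_exp; case: ifPn => [{}t0|_]; last by rewrite mulr_ge0.
have h : (t^-1) ^+ j.+1 / (j.+1)`!%:R <= expR t^-1.
  by have := @expR_ge1Dxn R t^-1 j ltac:(by rewrite invr_ge0 ltW); lra.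
rewrite expRN ler_pdivrMr ?expR_gt0//.
move: h; rewrite ler_pdivrMr ?ltr0n ?fact_gt0// exprS => h.
by rewrite -(ler_pM2l (_ : 0 < t^-1)) ?invr_gt0// (le_trans h)// le_eqVlt;
  apply/orP; left; apply/eqP; field; rewrite gt_eqF.
Qed.

Lemma flat_exp_ge0 j t : 0 <= flat_exp j t.
Proof.
rewrite /flat_exp; case: ifP => // t0.
by rewrite mulr_ge0 ?expR_ge0// exprn_ge0// invr_ge0 ltW.
Qed.

(** At the origin the difference quotient is [flat_exp j.+1 h], which is [O(h)]
    by [flat_exp_le]. *)
Lemma is_derive_flat_exp (j : nat) (t : R) :
  is_derive t (1 : R) (flat_exp j) ((- j%:R) * flat_exp j.+1 t + flat_exp j.+2 t).
Proof.
have [t0|t0|->] := ltgtP t 0.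
- rewrite /flat_exp ltNge (ltW t0)/= mulr0 addr0.
  apply: (@near_eq_is_derive _ _ _ (cst 0)).
  near=> x; rewrite ltNge; suff -> : x <= 0 by [].
  by near: x; apply: lt_le_nbhsl.
- have tn0 : t != 0 by rewrite gt_eqF.
  apply: (@near_eq_is_derive _ _ _ (fun x : R => (x^-1) ^+ j * expR (- x^-1) : R)).
    near=> x; rewrite /flat_exp; suff -> : 0 < x by [].
    by near: x; exact: lt_nbhsr.
  rewrite /flat_exp t0.
  have dV : is_derive t (1 : R) (fun x : R => x^-1) (- t ^- 2).
    apply: (is_derive_eq (@is_deriveV _ id t 1 1 tn0 (is_derive_id _ _))).
    by rewrite /GRing.scale/= mulr1.
  have dE : is_derive t (1 : R) (fun x : R => expR (- x^-1))
    (expR (- t^-1) * t ^- 2).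
    apply: (@is_derive1_comp _ expR (fun x => - x^-1)).
    by rewrite -[X in is_derive _ _ _ X]opprK; exact: is_deriveN.
  have dX : is_derive t (1 : R) (fun x : R => x^-1 ^+ j)
    (j%:R * t^-1 ^+ j.-1 * - t ^- 2).
    apply: (@is_derive1_comp _ (fun y : R => y ^+ j) (fun x : R => x^-1)).
    have -> : (fun y : R => y ^+ j) = (@id R) ^+ j by rewrite exprfctE.
    apply: (is_derive_eq (@is_deriveX _ _ (@id R) j _ 1 1 (is_derive_id _ _))).
    by rewrite /GRing.scale/= mulr1.
  apply: (is_derive_eq (is_deriveM dX dE)); rewrite /GRing.scale/=.
  case: j {dX} => [|j]; rewrite ?expr0 /= ?exprS; field => //.
- have f0 i : flat_exp i 0 = 0 by rewrite /flat_exp ltxx.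
  rewrite !f0 mulr0 addr0.
  pose C : R := (j.+2)`!%:R.
  have C0 : 0 < C by rewrite ltr0n fact_gt0.
  have H : h^-1 *: ((flat_exp j \o shift 0) (h *: (1 : R)) - flat_exp j 0)
    @[h --> 0^'] --> (0 : R).
    apply/cvgrPdist_le => e e0; near=> h.
    rewrite /= f0 addr0 !subr0 sub0r normrN /GRing.scale/= mulr1.
    have he : `|h| <= e / C.
      near: h; apply: dnbhs0_le; exact: divr_gt0.
    have [h0|h0] := leP h 0; first by rewrite /flat_exp ltNge h0/= mulr0 normr0 ltW.
    rewrite normrM !ger0_norm ?flat_exp_ge0 ?invr_ge0 ?(ltW h0)//.
    have -> : flat_exp j h = h * flat_exp j.+1 h.
      by rewrite /flat_exp h0 exprS mulrA mulrA divff ?mul1r// gt_eqF.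
    rewrite mulKf ?gt_eqF//; apply: (le_trans (flat_exp_le _ (ltW h0))).
    by rewrite -/C -ler_pdivlMl// mulrC (le_trans (ler_norm _) he).
  by split; [apply: cvgP H|apply: cvg_lim].
Unshelve. all: by end_near. Qed.

End smooth_line.

Section cutoff.
Context {R : realType}.
Let mu := @lebesgue_measure R.

Lemma smooth_upto_flat_exp k j : smooth_upto k (@flat_exp R j).
Proof.
elim: k j => // k IH j.
exists (fun t => - j%:R * flat_exp j.+1 t + flat_exp j.+2 t) => [t|].
  exact: is_derive_flat_exp.
by apply: smooth_uptoD => //; apply: smooth_uptoM => //; exact: smooth_upto_cst.
Qed.

(** The two factors make the support compact; exchanging them under [v -> -v] makes
    the product even, as [integral_cos_tensor] requires. *)
Definition cutoff (e v : R) : R :=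
  flat_exp 0 (e^-1 * v + 1) * flat_exp 0 (- e^-1 * v + 1).

Lemma smooth_cutoff e : smooth (cutoff e).
Proof. by move=> k; apply: smooth_uptoM; apply: smooth_upto_affine;
  exact: smooth_upto_flat_exp. Qed.

Lemma cutoff_even e v : cutoff e (- v) = cutoff e v.
Proof. by rewrite /cutoff mulrC; congr (flat_exp _ _ * flat_exp _ _); ring. Qed.

Lemma flat_exp0_le1 (t : R) : flat_exp 0 t <= 1.
Proof.
rewrite /flat_exp; case: ifPn => // t0; rewrite expr0 mul1r -expR0 ler_expR.
by rewrite oppr_le0 invr_ge0 ltW.
Qed.

Lemma cutoff_ge0_le1 e v : 0 <= cutoff e v <= 1.
Proof.
by rewrite mulr_ge0 ?flat_exp_ge0//= mulr_ile1 ?flat_exp_ge0 ?flat_exp0_le1.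
Qed.

Lemma cutoff_support e v : 0 < e -> e <= `|v| -> cutoff e v = 0.
Proof.
move=> e0 ev; rewrite /cutoff /flat_exp.
have [v0|v0] := leP 0 v.
  rewrite [X in _ * X]ifF ?mulr0//; apply/negbTE;
    rewrite -leNgt mulNr addrC subr_le0.
  by rewrite ler_pdivlMl// mulr1 -(ger0_norm v0).
rewrite [X in X * _]ifF ?mul0r//; apply/negbTE; rewrite -leNgt -lerBrDr sub0r.
by rewrite ler_pdivrMl// mulrN1 lerNr -(ltr0_norm v0).
Qed.

Lemma cutoff_lower e v : 0 < e -> `|v| <= e / 2 -> expR (- 4) <= cutoff e v.
Proof.
move=> e0 ev.
have flat2 t : 2^-1 <= t -> expR (- 2) <= flat_exp 0 t :> R.
  move=> t2; have t0 : 0 < t by lra.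
  rewrite /flat_exp t0 expr0 mul1r ler_expR lerN2 -[leRHS]invrK lef_pV2 ?posrE
    ?invr_gt0//.
have ev' : `|e^-1 * v| <= 2^-1.
  by rewrite normrM gtr0_norm ?invr_gt0// ler_pdivrMl.
move: ev'; rewrite ler_norml => /andP[h1 h2].
rewrite (_ : - 4 = - 2 + - 2 :> R); last by ring.
rewrite expRD; apply: ler_pM; rewrite ?expR_ge0//; apply: flat2;
  last rewrite mulNr; lra.
Qed.

Lemma continuous_smooth (u : R -> R) : smooth u -> continuous u.
Proof.
move=> /smooth_derive[_ du] x.
by apply/differentiable_continuous/derivable1_diffP; exact: ex_derive.
Qed.

Lemma cutoff_itv_ind_le e v : 0 < e -> cutoff e v <= itv_ind (- e) (2 * e) v.
Proof.
move=> e0; have [ve|ve] := leP e `|v|;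
  first by rewrite cutoff_support// itv_ind_ge0.
rewrite /itv_ind indicE mem_setE in_itv/= (_ : - e + _ = e); last by ring.
by rewrite -ler_norml (ltW ve); have /andP[] := cutoff_ge0_le1 e v.
Qed.

Lemma integrable_cutoff e : 0 < e -> mu.-integrable setT (EFin \o cutoff e).
Proof.
move=> e0; have ii : mu.-integrable setT (EFin \o itv_ind (- e) (2 * e)).
  by apply: integrable_itv_ind; rewrite mulr_gt0.
apply: integrable_dominated ii => [|v].
  by apply: continuous_measurable_fun; apply: continuous_smooth;
    exact: smooth_cutoff.
have /andP[b0 _] := cutoff_ge0_le1 e v.
by rewrite ger0_norm// cutoff_itv_ind_le.
Qed.

Section tensor_smooth.
Context {n : nat}.
Implicit Types h : 'I_n -> R -> R.

Lemma differentiable_tensor h (x : 'rV[R]_n) :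
  (forall i, smooth (h i)) -> differentiable (tensor h) x.
Proof.
move=> sh; rewrite /tensor; elim: (index_enum _) => [|i s IH].
  by under eq_fun do rewrite big_nil; exact: differentiable_cst.
under eq_fun do rewrite big_cons.
apply: differentiableM => //.
apply: (@differentiable_comp _ _ _ _ (fun y : 'rV[R]_n => y ord0 i) (h i)).
  exact: differentiable_coord.
by apply/derivable1_diffP; have [_ dh] := smooth_derive (sh i); exact: ex_derive.
Qed.

Definition tensor_diff h (j : 'I_n) : 'I_n -> R -> R :=
  fun i => if i == j then derive1 (h i) else h i.

(** Only one factor varies along a coordinate direction, so the difference quotient
    of the product is that of this factor, times the other ones. *)
Lemma derive_tensor h (j : 'I_n) (x : 'rV[R]_n) : (forall i, smooth (h i)) ->
  'D_(delta_mx ord0 j) (tensor h) x = tensor (tensor_diff h j) x.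
Proof.
move=> sh; have [_ dh] := smooth_derive (sh j).
pose C := \prod_(i < n | i != j) h i (x ord0 i).
have -> : tensor (tensor_diff h j) x = C * derive1 (h j) (x ord0 j).
  rewrite /tensor (bigD1 j)//= {1}/tensor_diff eqxx mulrC; congr (_ * _).
  by apply: eq_bigr => i /negPf ij; rewrite /tensor_diff ij.
have [der dval] := dh (x ord0 j).
have cv : (fun t => t^-1 *: ((h j \o shift (x ord0 j)) (t *: (1 : R)) - h j
  (x ord0 j))) @ 0^' -->
    derive1 (h j) (x ord0 j).
  by rewrite -dval; exact: der.
rewrite /derive; apply/cvg_lim => //.
have H := @cvgMl_tmp _ _ _ (dnbhs_filter _) _ C _ cv.
refine (cvg_trans _ H); apply: near_eq_cvg; near=> t.
rewrite /= /GRing.scale/= mulr1 mulrCA; congr (_ * _).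
have tE y : tensor h y = h j (y ord0 j) * \prod_(i < n | i != j) h i (y ord0 i).
  by rewrite /tensor (bigD1 j).
rewrite !tE -/C !mxE !eqxx mulr1 (_ : \prod_(i < n | i != j) _ = C); last first.
  by apply: eq_bigr => i /negPf ij; rewrite !mxE ij andbF mulr0 add0r.
ring.
Unshelve. all: by end_near. Qed.

Lemma smooth_tensor_diff h j : (forall i, smooth (h i)) ->
  forall i, smooth (tensor_diff h j i).
Proof.
move=> sh i; rewrite /tensor_diff; case: ifP => // _.
by have [] := smooth_derive (sh i).
Qed.

Lemma cpartials_tensor h (s : seq 'I_n) : (forall i, smooth (h i)) ->
  exists2 h', forall i, smooth (h' i) &
    cpartials s (fun x => (tensor h x)%:C%C) = (fun x => (tensor h' x)%:C%C).
Proof.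
move=> sh; elim: s => [|j s [h' sh' E]]; first by exists h.
exists (tensor_diff h' j) => [i|]; first exact: smooth_tensor_diff.
rewrite /= E; apply/funext => x; rewrite /cpartial/= derive_tensor//.
by rewrite (derive_cst (0 : R)).
Qed.

Lemma csmooth_tensor h : (forall i, smooth (h i)) ->
  csmooth (fun x : 'rV[R]_n => (tensor h x)%:C%C).
Proof.
move=> sh s x; have [h' sh' ->] := cpartials_tensor s sh; split=> /=.
  exact: differentiable_tensor.
exact: differentiable_cst.
Qed.

Lemma test_function_cutoff (e d : R) (U : set 'rV[R]_n) : 0 < e -> e < d ->
  ball 0 d `<=` U ->
  test_function_on U (fun x => (tensor (fun=> cutoff e) x)%:C%C).
Proof.
move=> e0 ed dU.
have sub : closure [set x : 'rV[R]_n | (tensor (fun=> cutoff e) x)%:C%C != 0] `<=`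
    closed_ball_ Num.norm 0 e.
  rewrite [X in _ `<=` X](closure_id _).1; last exact: closed_closed_ball_.
  apply: closure_subset => x /=.
  rewrite /closed_ball_/= sub0r normrN leNgt; apply: contraNN => xe.
  have [[i j] /= xij] : exists ij : 'I_1 * 'I_n, `|x| = `|x ij.1 ij.2|.
    by apply: mx_norm_neq0; rewrite gt_eqF// (lt_trans e0).
  rewrite (_ : tensor _ x = 0) ?eqxx//.
  rewrite /tensor (bigD1 j)//= cutoff_support ?mul0r//.
  by move: xij; rewrite (ord1 i) => <-; exact: ltW.
split.
- by apply: csmooth_tensor => i; exact: smooth_cutoff.
- apply: bounded_closed_compact; last exact: closed_closure.
  exists e; split; first exact: num_real.
  move=> M eM x /sub; rewrite /closed_ball_/= sub0r normrN => xe.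
  exact: le_trans xe (ltW eM).
- move=> x /sub; rewrite /closed_ball_/= sub0r normrN => xe; apply: dU.
  by rewrite mx_norm_ball /ball_/= sub0r normrN (le_lt_trans xe).
Qed.

End tensor_smooth.
End cutoff.

(** * Discontinuity of the Fourier transform at the origin *)

Section discontinuity.
Context {R : realType}.
Let mu := @lebesgue_measure R.

Definition cutoff_fourier (e u : R) : R := \int[mu]_v (cos (v * u) * cutoff e v).

(** The transform of an even tensor product is again a tensor product. *)
Lemma Re_fourier_cutoff n (e : R) : 0 < e ->
  (fun xi => complex.Re
    (fourier (fun x : 'rV[R]_n => (tensor (fun=> cutoff e) x)%:C%C) xi)) =
  tensor (fun=> cutoff_fourier e).
Proof.
move=> e0; apply/funext => xi; rewrite /fourier /cintegral/=.
have [_ _ cE _] := integral_cos_tensor xi (fun i : 'I_n => integrable_cutoff e0)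
  (fun i : 'I_n => cutoff_even e).
rewrite -[RHS]cE; apply: eq_Rintegral => x _.
by rewrite /cis/= cosN mulr0 subr0.
Qed.

Definition cutoff_pairing (e : R) (k : nat) : R :=
  \int[mu]_u (tent (2^-1 ^+ k * u) * cutoff_fourier e u).

Lemma tent_pairing_cutoff n e k : 0 < e ->
  tent_pairing k (tensor (fun _ : 'I_n => cutoff_fourier e)) =
    cutoff_pairing e k ^+ n.
Proof.
move=> e0; rewrite /tent_pairing.
have s0 : 0 < 2^-1 ^+ k :> R by rewrite exprn_gt0// invr_gt0.
have [ii _] := tent_cos_pairing s0 (lexx 0) (integrable_cutoff e0)
  (cutoff_ge0_le1 e)
  (fun v _ => (andP (cutoff_ge0_le1 e v)).1).
have [_ tE] := integrable_tensor (fun _ : 'I_n => ii).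
rewrite -[X in _ ^+ X](card_ord n) -prodr_const -[RHS]tE.
by apply: eq_Rintegral => x _; rewrite /dyadic_tent tensorM.
Qed.

Lemma cutoff_pairing_bounds e k : 0 < e -> 0 <= cutoff_pairing e k <= 8 * pi.
Proof.
move=> e0.
have s0 : 0 < 2^-1 ^+ k :> R by rewrite exprn_gt0// invr_gt0.
have [_] := tent_cos_pairing s0 (lexx 0) (integrable_cutoff e0) (cutoff_ge0_le1 e)
  (fun v _ => (andP (cutoff_ge0_le1 e v)).1).
by rewrite !mul0r.
Qed.

Lemma cutoff_pairing_lower m :
  expR (- 4) * cos 1 / 2 <= cutoff_pairing (2^-1 ^+ m) m.
Proof.
have s0 : 0 < 2^-1 ^+ m :> R by rewrite exprn_gt0// invr_gt0.
have [_ /andP[]//] := tent_cos_pairing s0 (expR_ge0 (- 4)) (integrable_cutoff s0)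
  (cutoff_ge0_le1 _) (fun v => cutoff_lower s0).
Qed.

(** All the terms are nonnegative, so a single one bounds the sum from below. The
    index [m] is chosen to match the width [2 ^ -m] of the cutoff. *)
Lemma tent_functional_cutoff_lower n a m : 0 < a -> (0 < n)%N ->
  tent_coef n a ^+ m * (expR (- 4) * cos 1 / 2) ^+ n <=
  tent_functional a (tensor (fun _ : 'I_n => cutoff_fourier (2^-1 ^+ m))) :> R.
Proof.
move=> a0 n0; set e := 2^-1 ^+ m.
have e0 : 0 < e :> R by rewrite exprn_gt0// invr_gt0.
have /andP[c0 c1] := @tent_coef_bound R n a a0 n0.
have b0 : 0 <= expR (- 4) * cos 1 / 2 :> R.
  by rewrite divr_ge0// mulr_ge0 ?expR_ge0// ltW// cos1_gt0.
pose u k := tent_coef n a ^+ k * tent_pairing k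
  (tensor (fun _ : 'I_n => cutoff_fourier e)).
have u0 k : 0 <= u k.
  rewrite /u tent_pairing_cutoff// mulr_ge0 ?exprn_ge0 ?(ltW c0)//.
  by have /andP[] := cutoff_pairing_bounds k e0.
have [cu _] : cvgn (series u) /\ `|limn (series u)| <= (8 * pi) ^+ n /
  (1 - tent_coef n a).
  apply: geometric_series_bound => [|k]; first exact/andP.
  rewrite ger0_norm// /u tent_pairing_cutoff// mulrC ler_wpM2r ?exprn_ge0
    ?(ltW c0)//.
  have /andP[p0 p8] := cutoff_pairing_bounds k e0.
  by rewrite lerXn2r ?nnegrE// (le_trans p0).
apply: (@le_trans _ _ (u m)).
  rewrite /u tent_pairing_cutoff// ler_wpM2l ?exprn_ge0 ?(ltW c0)//.
  have bl := cutoff_pairing_lower m.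
  by rewrite lerXn2r ?nnegrE// (le_trans b0).
apply: (@le_trans _ _ (series u m.+1)).
  by rewrite /series/= big_nat_recr//= lerDr sumr_ge0.
apply: (nondecreasing_cvgn_le _ cu).
by apply: nondecreasing_series => k _ _.
Qed.

Lemma tent_coef_growth n a : a < 1 -> (0 < n)%N -> 1 < tent_coef n a * 2 ^+ n :> R.
Proof.
move=> a1 n0; rewrite /tent_coef -exprMn exprn_egt1 -?lt0n//.
have -> : 2^-1 `^ ((1 + a) / 2) * 2 = 2 `^ ((1 - a) / 2) :> R.
  transitivity (2 `^ (- 1 * ((1 + a) / 2)) * 2 `^ 1 : R).
    by rewrite [X in _ = X * _]powRrM powR_inv1// powRr1.
  rewrite -powRD ?pnatr_eq0 ?implybT//.
  by congr (_ `^ _); field.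
have e1 : 1 `^ ((1 - a) / 2) = 1 :> R by rewrite powR1.
rewrite -[ltLHS]e1; apply: gt0_ltr_powR; rewrite ?nnegrE ?ltr1n//; lra.
Qed.

(** Comparing the lower bound [c ^ m * b ^ n] with the upper bound
    [2 * M * (2 * 2 ^ -m) ^ n] gives [1 <= K * (c * 2 ^ n) ^ -m] for all large
    [m], against [c * 2 ^ n > 1]. *)
Lemma tent_distr_not_continuous n a : 0 < a -> a < 1 -> (0 < n)%N ->
  ~ distr_continuous_at (fourier_distr
    (tent_distr a : ('rV[R]_n -> R[i]) -> R[i])) 0.
Proof.
move=> a0 a1 n0 [U [g [[oU U0] [_ TE] cg _]]].
pose M : R := `|complex.Re (g 0)| + 1.
have M0 : 0 <= M by rewrite addr_ge0.
have /nbhs_ballP[d /= d0 dU] : nbhs (0 : 'rV[R]_n)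
  (U `&` [set x | `|complex.Re (g x)| <= M]).
  apply: filterI; first exact: open_nbhs_nbhs.
  have /cvgrPdist_le/(_ 1 ltr01) := cg.
  apply: filterS => x /= gx; rewrite /M -lerBlDl (le_trans _ gx)//.
  by rewrite distrC (le_trans (lerB_dist _ _)).
pose b : R := expR (- 4) * cos 1 / 2.
have b0 : 0 < b by rewrite divr_gt0// mulr_gt0 ?expR_gt0// cos1_gt0.
pose z : R := (tent_coef n a * 2 ^+ n)^-1.
have x1 := tent_coef_growth a1 n0.
pose K : R := 2 * (M * 2 ^+ n) / b ^+ n.
have key m : 2^-1 ^+ m < d -> 1 <= K * z ^+ m.
  set e := 2^-1 ^+ m => ed.
  have e0 : 0 < e by rewrite exprn_gt0// invr_gt0.
  have := TE _ (test_function_cutoff e0 ed (subset_trans dU (@subIsetl _ _ _))).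
  move/(congr1 (@complex.Re R)); rewrite /fourier_distr /tent_distr/=.
  rewrite Re_fourier_cutoff// => E.
  have lo := @tent_functional_cutoff_lower n a m a0 n0; rewrite E in lo.
  have t0 (x : 'rV[R]_n) : 0 <= tensor (fun=> cutoff e) x.
    by apply: tensor_ge0 => i u; have /andP[] := cutoff_ge0_le1 e u.
  have up : `|(\int[lebesgue_rV R n]_(x in U)
      complex.Re (g x * (tensor (fun=> cutoff e) x)%:C%C))%R| <= 2 *
        (M * (2 * e) ^+ n).
    apply: (normr_Rintegral_le (g := fun x => M * tensor (fun=> cutoff e) x)).
    - exact: open_measurable_rV.
    - move=> x Ux.
      have -> : complex.Re (g x * (tensor (fun=> cutoff e) x)%:C%C) =
          complex.Re (g x) * tensor (fun=> cutoff e) x.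
        by case: (g x) => ? ? /=; rewrite mulr0 subr0.
      rewrite normrM (ger0_norm (t0 x)).
      have [xd|xd] := ltP `|x| d.
        rewrite ler_wpM2r//; apply: (dU x _).2.
        by rewrite mx_norm_ball /ball_/= sub0r normrN.
      suff -> : tensor (fun=> cutoff e) x = 0 by rewrite !mulr0.
      have [[i j] /= xij] : exists ij : 'I_1 * 'I_n, `|x| = `|x ij.1 ij.2|.
        by apply: mx_norm_neq0; rewrite gt_eqF// (lt_le_trans d0).
      rewrite /tensor (bigD1 j)//= cutoff_support ?mul0r//.
      by move: xij; rewrite (ord1 i) => <-; apply: le_trans xd; exact: ltW.
    - by move=> x; rewrite mulr_ge0.
    - have mb : measurable_fun setT (cutoff e : R -> R).
        by apply: continuous_measurable_fun; apply: continuous_smooth;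
          exact: smooth_cutoff.
      under eq_integral do rewrite EFinM.
      rewrite ge0_integralZl_EFin//; last 2 first.
      + by move=> x _; rewrite lee_fin.
      + by apply/measurable_EFinP; apply: measurable_tensor.
      rewrite EFinM lee_wpmul2l ?lee_fin// -[X in _ ^+ X](card_ord n) -prodr_const.
      apply: ge0_integral_tensor_le => // [i u|i];
        first by have /andP[] := cutoff_ge0_le1 e u.
      rewrite -(integral_itv_ind (- e)) ?mulr_gt0//.
      apply: ge0_le_integral_bound => u _; rewrite lee_fin.
        by have /andP[] := cutoff_ge0_le1 e u.
      exact: cutoff_itv_ind_le.
  have := le_trans lo (le_trans (ler_norm _) up).
  rewrite -/b -ler_pdivlMr ?exprn_gt0// => H.
  have c0 : 0 < tent_coef n a by have /andP[] := @tent_coef_bound R n a a0 n0.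
  have xm : (tent_coef n a * 2 ^+ n) ^+ m = tent_coef n a ^+ m / e ^+ n.
    by rewrite exprMn /e exprVn exprVn invrK -!exprM mulnC.
  rewrite /z exprVn ler_pdivlMr ?exprn_gt0 ?(lt_trans ltr01)// mul1r xm.
  rewrite ler_pdivrMr ?exprn_gt0//; apply: (le_trans H).
  by rewrite /K exprMn le_eqVlt; apply/orP; left; apply/eqP; ring.
have z1 : `|z| < 1.
  by rewrite ger0_norm ?invr_ge0 ?(ltW (lt_trans ltr01 x1))// invf_lt1//
    (lt_trans ltr01).
have h1 : `|2^-1 : R| < 1 by rewrite ger0_norm ?invr_ge0// invf_lt1// ltr1n.
have /cvgrPdist_lt/(_ 1 ltr01)[N1 _ HN1] := cvg_geometric K z1.
have /cvgrPdist_lt/(_ d d0)[N2 _ HN2] := cvg_geometric (1 : R) h1.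
have /= := HN1 (maxn N1 N2) (leq_maxl _ _);
  have /= := HN2 (maxn N1 N2) (leq_maxr _ _).
rewrite !sub0r !normrN mul1r => /(le_lt_trans (ler_norm _)) /key K1.
by move=> /(le_lt_trans (ler_norm _)); rewrite ltNge K1.
Qed.

End discontinuity.

(** * The theorem *)

Theorem proposition3p5 (R : realType) (n : nat) (q lambda : R)
    (phi : 'rV[R]_n -> R[i])
    (n_gt0 : (0 < n)%N) (q_gt0 : 0 < q) (q_le1 : q <= 1) (lambda_gt1 : 1 < lambda)
    (phi_schwartz : schwartz phi) (phi_int : cintegral setT phi != 0) :
  exists f : ('rV[R]_n -> R[i]) -> R[i],
    hardy_morrey phi q lambda f /\
    ~ distr_continuous_at (fourier_distr f) 0.
Proof.
exists (tent_distr lambda^-1); split; first exact: hardy_morrey_tent_distr.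
apply: tent_distr_not_continuous => //; first by rewrite invr_gt0 (lt_trans ltr01).
by rewrite invf_lt1 // (lt_trans ltr01).
Qed.
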